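(* Let $k\ge 3$ be an integer. There exist constants $c=c(k)>0$ and $n_0=n_0(k)$ such that for every $n\ge n_0$ the following holds: if $G$ is a graph on $n$ vertices with $q(G)\ge q(T_{n,k})$ and $G$ is not isomorphic to $T_{n,k}$, then $G$ contains a copy of $K_k^{+}[t]$ for some $t\ge c\log n$.
   Context: All graphs are finite and simple. $q(G)$ denotes the largest eigenvalue of the signless Laplacian $Q(G)=D(G)+A(G)$ ($D(G)$ the diagonal degree matrix, $A(G)$ the adjacency matrix). The Turán graph $T_{n,k}$ is the complete $k$-partite graph on $n$ vertices whose part sizes differ by at most one. $K_k[t]$ is the complete $k$-partite graph with all parts of size $t$, and $K_k^{+}[t]$ is the graph obtained from $K_k[t]$ by adding exactly one edge inside one of the parts. *)

(* Defs.v *)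
From HB Require Import structures.
From mathcomp Require Import all_boot all_order all_algebra.
From mathcomp Require Import all_classical all_reals exp.
Set Implicit Arguments. Unset Strict Implicit. Unset Printing Implicit Defensive.
Import Order.TTheory GRing.Theory Num.Theory.
Local Open Scope ring_scope.
Local Open Scope classical_set_scope.

Definition simple_graph (T : finType) (G : rel T) : Prop :=
  symmetric G /\ irreflexive G.

Definition adjmx (R : realType) (n : nat) (G : rel 'I_n) : 'M[R]_n :=
  \matrix_(i, j) (G i j)%:R.

Definition deg (n : nat) (G : rel 'I_n) (i : 'I_n) : nat := #|[set j | G i j]|.

Definition signless_laplacian (R : realType) (n : nat) (G : rel 'I_n) : 'M[R]_n :=
  \matrix_(i, j) ((i == j)%:R * (deg G i)%:R) + adjmx R G.

(* q(G): the largest eigenvalue of Q(G) (over the reals, where all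
   eigenvalues of the symmetric matrix Q(G) live). *)
Definition q (R : realType) (n : nat) (G : rel 'I_n) : R :=
  sup [set l : R | eigenvalue (signless_laplacian R G) l].

(* Turán graph T_{n,k}: vertex i lies in part (i mod k); parts have sizes
   differing by at most one; complete k-partite. *)
Definition turan (n k : nat) : rel 'I_n := fun i j => (i %% k != j %% k)%N.

Definition isomorphic (n : nat) (G H : rel 'I_n) : Prop :=
  exists f : 'I_n -> 'I_n, bijective f /\ forall i j, G i j = H (f i) (f j).

(* K_k^+[t]: vertices (part, index) in 'I_k * 'I_t; two vertices in different
   parts are adjacent; additionally one edge inside part 0 between the
   vertices of index 0 and 1 (meaningful for t >= 2). *)
Definition Kplus (k t : nat) : rel ('I_k * 'I_t) := fun u v =>
  (u.1 != v.1) ||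
  [&& (nat_of_ord u.1 == 0%N), (nat_of_ord v.1 == 0%N) &
      ((nat_of_ord u.2 == 0%N) && (nat_of_ord v.2 == 1%N)) ||
      ((nat_of_ord u.2 == 1%N) && (nat_of_ord v.2 == 0%N))].

Definition contains_copy (T : finType) (n : nat) (G : rel 'I_n) (H : rel T) : Prop :=
  exists f : T -> 'I_n, injective f /\ forall u v, H u v -> G (f u) (f v).
Arguments turan : clear implicits.
Arguments Kplus : clear implicits.
Arguments q : clear implicits.

(* Main.v *)
Require Import Defs.
From HB Require Import structures.
From mathcomp Require Import all_boot all_order all_algebra all_fingroup.
From mathcomp Require Import all_classical all_reals exp.
From mathcomp Require Import topology normedtype derive realfun sequences.
From mathcomp Require Import ring lra zify.
Import Order.TTheory GRing.Theory Num.Theory.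
Import numFieldNormedType.Exports.
Set Implicit Arguments. Unset Strict Implicit. Unset Printing Implicit Defensive.

(** Write a = 1 - 1/k. A Zykov symmetrisation (replacing vertices by clones of a
    non-neighbour, which only pulls the graph back along a map of the vertices)
    shows that a K_(k+1)-free graph with the largest q is complete k-partite, and
    concavity of the share s / (q - n + 2 s) of a colour class of size s in the
    Perron vector makes the Turan graph the only maximiser. So G contains
    K_(k+1). If some degree is below (a - eps) n, deleting the vertex with the
    smallest Perron entry increases the density q / n by a definite multiple of
    1 / n; as q <= 2 n this stops after losing a constant proportion of the
    vertices, at a graph of large minimum degree whose q still forces a
    K_(k+1). In such a graph the vertices of the clique can be exchanged one at
    a time for linearly many others, down to an edge uv, so a positive
    proportion of the k-tuples are cliques whose first k - 1 vertices are common
    neighbours of u and v. A dense family of k-tuples contains a complete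
    k-partite block of logarithmic size; putting u and v into its last part
    gives K_k^+[t]. *)

(** * Dense families of cliques *)

Local Open Scope nat_scope.

Definition many (V : finType) N (A : pred V) := #|V| <= N * #|A|.

(* The nested quantifier "for many w_1, for many w_2, ..., for many w_r" stands
   in for counting r-tuples: extending tuples then needs no averaging. *)
Fixpoint dense (V : finType) N r (P : pred (seq V)) : bool :=
  if r is r'.+1 then dense N r' (fun s => many N (fun w => P (rcons s w))) else P [::].

Section Dense.
Variable V : finType.
Implicit Types (A B : pred V) (P : pred (seq V)).

Lemma many_mono N (A B : pred V) : (forall w, A w -> B w) -> many N A -> many N B.
Proof.
move=> AB /leq_trans; apply; rewrite leq_mul2l; apply/orP; right.
by apply: subset_leq_card; apply/fintype.subsetP => w; exact: AB.
Qed.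

Lemma dense_mono N r P P' : (forall s, P s -> P' s) -> dense N r P -> dense N r P'.
Proof.
elim: r P P' => [|r IH] P P' PP' /=; first exact: PP'.
by apply: IH => s; apply: many_mono => w; exact: PP'.
Qed.

Lemma many_has (I : eqType) (L : seq I) N (A : I -> pred V) : 0 < #|V| ->
  many N (fun w => has (A^~ w) L) -> has (fun i => many (N * size L) (A i)) L.
Proof.
move=> V0; rewrite /many => h; apply/negPn/negP => /hasPn nh.
have L0 : 0 < size L.
  case: (L) h => //= /leq_trans /(_ _) h'; move: V0; rewrite ltnNge => /negP; case; apply: h'.
  by rewrite (eq_card0 (A := pred0)) // muln0.
have cU : #|[pred w | has (A^~ w) L]| <= \sum_(i <- L) #|A i|.
  rewrite -sum1_card (eq_bigr (fun i => \sum_w A i w)) => [|i _]; last first.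
    by rewrite -sum1_card big_mkcond; apply: eq_bigr => w _; rewrite unfold_in; case: (A i w).
  rewrite exchange_big /= big_mkcond; apply: leq_sum => w _; rewrite unfold_in.
  case: ifP => // /hasP[i iL Ai]; rewrite (big_rem i) //= Ai; exact: leq_addr.
have : \sum_(i <- L) (N * size L * #|A i| + 1) <= \sum_(i <- L) #|V|.
  rewrite big_seq [leqRHS]big_seq; apply: leq_sum => i iL.
  by rewrite addn1 ltnNge; exact: nh.
rewrite big_split /= -big_distrr /= !big_const_seq !count_predT !iter_addn_0 mul1n.
set T := \sum_(i <- L) _ in cU *.
move: h cU L0; move: (size L) (#|_|) => l a h cU L0.
have : l * #|V| <= l * (N * T) by rewrite leq_mul2l (leq_trans h) ?orbT // leq_mul2l cU orbT.
by move: (#|V|) => v; lia.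
Qed.

Lemma dense_has (I : eqType) (L : seq I) N r (P : I -> pred (seq V)) : 0 < #|V| ->
  dense N r (fun s => has (P^~ s) L) -> exists2 i, i \in L & dense (N * size L) r (P i).
Proof.
move=> V0; elim: r P => [|r IH] P /=; first by move/hasP.
move=> h; have := IH (fun i s => many (N * size L) (fun w => P i (rcons s w))); apply.
by apply: dense_mono h => s; exact: many_has.
Qed.

Lemma injective_into (A : {set V}) m : m <= #|A| ->
  exists h : 'I_m -> V, injective h /\ forall i, h i \in A.
Proof.
move=> mA; exists (fun i => enum_val (widen_ord mA i)); split => [i j|i].
  by move/enum_val_inj/(congr1 val) => /= ?; exact: val_inj.
exact: enum_valP.
Qed.

End Dense.

(* From [2 N m] blocks for the first [r] coordinates, a positive fraction of
   the vertices extend at least [m] of them; there are only [2 ^ (2 N m)] sets of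
   blocks, so [m] vertices extend a common family of [m] blocks. *)
Lemma dense_blocks N r : 0 < N -> exists C,
  forall (V : finType) (G : rel V) (P : pred (seq V)) x0 m,
  symmetric G -> irreflexive G ->
  (forall s, P s -> (size s == r) && pairwise G s) -> dense N r P -> 2 ^ (C * m) <= #|V| ->
  exists A : 'I_m -> seq V, [/\ forall i, P (A i),
    forall i j a b, a < r -> b < r -> a != b -> G (nth x0 (A i) a) (nth x0 (A j) b) &
    forall a, a < r -> injective (fun i => nth x0 (A i) a)].
Proof.
move=> N0; elim: r => [|r [C IH]].
  by exists 0 => V G P x0 m _ _ _ P0 _; exists (fun=> [::]); split.
exists (C * (2 * N) + 4 * N) => V G P x0 m sG iG hP dP mV.
have [m0|m0] := posnP m.
  by subst m; exists (fun=> [::]); split => [[]|[]|a _ []].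
set M := 2 * N * m.
pose Q s := many N (fun w => P (rcons s w)).
have V0 : 0 < #|V| by apply: leq_trans mV; rewrite expn_gt0.
have hQ s : Q s -> (size s == r) && pairwise G s.
  rewrite /Q /many => h; have : 0 < #|[pred w | P (rcons s w)]|.
    by rewrite lt0n; apply: contraL V0 => /eqP c0; move: h; rewrite c0 muln0 leqn0 => /eqP ->.
  case/card_gt0P => w; rewrite unfold_in => /hP.
  by rewrite size_rcons eqSS pairwise_rcons => /and3P[-> _ ->].
have [|A [QA crossA injA]] := IH V G Q x0 M sG iG hQ dP.
  apply: leq_trans mV; rewrite leq_exp2l // /M; lia.
pose D w : {set 'I_M} := [set i | P (rcons (A i) w)]%SET.
pose W : {set V} := [set w | m <= #|D w|]%SET.
have sumD : M * #|V| <= N * \sum_w #|D w|.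
  have -> : \sum_w #|D w| = \sum_(i < M) #|[pred w | P (rcons (A i) w)]|.
    under eq_bigr do rewrite -sum1_card big_mkcond.
    rewrite exchange_big /=; apply: eq_bigr => i _; rewrite -sum1_card [RHS]big_mkcond.
    by apply: eq_bigr => w _; rewrite inE unfold_in.
  have -> : M * #|V| = \sum_(i < M) #|V| by rewrite sum_nat_const card_ord.
  by rewrite big_distrr /=; apply: leq_sum => i _; exact: QA.
have cW : #|V| <= 2 * N * #|W|.
  have : \sum_w #|D w| <= \sum_w ((w \in W) * M + m).
    apply: leq_sum => w _; rewrite inE; case: (leqP m #|D w|) => [_|/ltnW //].
    by rewrite mul1n (leq_trans (max_card _)) // card_ord leq_addr.
  rewrite big_split /= -big_distrl /= sum_nat_const.
  have -> : \sum_w (w \in W) = #|W|.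
    by rewrite -sum1_card [RHS]big_mkcond; apply: eq_bigr => w _; case: (w \in W).
  move=> h; have : M * #|V| <= N * (#|W| * M + #|V| * m).
    by apply: leq_trans sumD _; rewrite leq_mul2l h orbT.
  rewrite /M; have -> : N * (#|W| * (2 * N * m) + #|V| * m) =
    N * m * (2 * N * #|W|) + N * m * #|V| by ring.
  have -> : 2 * N * m * #|V| = N * m * #|V| + N * m * #|V| by ring.
  by rewrite leq_add2r leq_mul2l muln_eq0 !eqn0Ngt N0 m0.
have [I hI] : exists I, m <= #|[set w in W | D w == I]%SET|.
  apply/existsP; apply: contraT; rewrite negb_exists => /forallP h.
  have : #|W| <= \sum_(I : {set 'I_M}) m.
    rewrite -sum1_card (partition_big D xpredT) //=; apply: leq_sum => I _.
    rewrite sum1dep_card ltnW // ltnNge; apply: h.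
  rewrite sum_nat_const -cardsT -powersetT card_powerset cardsT card_ord => h2.
  have : #|V| <= 2 ^ M * M.
    apply: leq_trans cW _; rewrite /M in h2 *.
    by apply: leq_trans (_ : 2 * N * (2 ^ (2 * N * m) * m) <= _);
      [rewrite leq_mul2l h2 orbT|apply/eq_leq; ring].
  rewrite leqNgt => /negP; case; apply: leq_trans mV.
  apply: leq_trans (_ : 2 ^ M * 2 ^ M <= _); first by rewrite ltn_pmul2l ?expn_gt0 // ltn_expl.
  by rewrite -expnD leq_exp2l // /M; lia.
have [w [injw wI]] := injective_into hI.
have mI : m <= #|I|.
  by have := wI (Ordinal m0); rewrite !inE => /andP[h /eqP <-].
have [h [injh hhI]] := injective_into mI.
have PA i j : P (rcons (A (h i)) (w j)).
  by have := hhI i; have := wI j; rewrite !inE => /andP[_ /eqP <-]; rewrite inE.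
have sA i : size (A i) = r by have /hQ /andP[/eqP] := QA i.
have adj i j a : a < r -> G (nth x0 (A (h i)) a) (w j).
  move=> ar; have /hP/andP[_] := PA i j; rewrite pairwise_rcons => /andP[/allP hall _].
  by apply: hall; rewrite mem_nth ?sA.
exists (fun i => rcons (A (h i)) (w i)); split => [i|i j a b|a]; first exact: PA.
  rewrite !nth_rcons !sA ltnS leq_eqVlt => /orP[/eqP ->|ar];
    rewrite ltnS leq_eqVlt => /orP[/eqP ->|br] ab.
  - by rewrite eqxx in ab.
  - by rewrite ltnn eqxx br sG; exact: adj.
  - by rewrite ltnn eqxx ar; exact: adj.
  by rewrite ar br; exact: crossA.
rewrite ltnS leq_eqVlt => /orP[/eqP ->|ar] i j /=; rewrite !nth_rcons !sA.
  by rewrite ltnn eqxx => /injw.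
by rewrite ar => /(injA a ar) /injh.
Qed.

Section Joints.
Variables (V : finType) (G : rel V) (k : nat).
Hypotheses (sG : symmetric G) (k_ge2 : 2 <= k).
Let n := #|V|.
(* Every degree is at least [(1 - 1/k - 1/(4 k^2)) n]. *)
Hypothesis codeg : forall z, 4 * k ^ 2 * #|[pred w | ~~ G w z]| <= (4 * k + 1) * n.

Lemma sum_nonadj (L : seq V) :
  4 * k ^ 2 * \sum_w count (fun z => ~~ G w z) L <= size L * ((4 * k + 1) * n).
Proof.
elim: L => [|z L IH] /=; first by rewrite big1 ?muln0.
rewrite big_split /= mulnDr mulSn leq_add //; apply: leq_trans (codeg z).
rewrite leq_mul2l -sum1_card [leqRHS]big_mkcond /=; apply/orP; right; apply: leq_sum => w _.
by rewrite unfold_in /=; case: (G w z).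
Qed.

Lemma many_common_nbrs (L : seq V) : size L = k.-1 -> many (4 * k) (fun w => all (G w) L).
Proof.
move=> sL; have := sum_nonadj L; rewrite sL /many -/n.
set c := #|_|.
have : n <= c + \sum_w count (fun z => ~~ G w z) L.
  have -> : n = \sum_(w : V) 1 by rewrite sum1_card.
  rewrite /c -sum1_card [X in X + _]big_mkcond -big_split; apply: leq_sum => w _ /=.
  by rewrite unfold_in /=; case: allP => // /allP; rewrite -has_predC has_count.
move: (\sum_w _) (n) c => s m c h1 h2; nia.
Qed.

(* A vertex [w] not of this kind has at least two non-neighbours in the clique
   [R ++ S] when those in [R] are counted twice. *)
Lemma many_swaps (R S : seq V) : size R + size S = k.+1 -> 3 <= size S ->
  many (4 * k) (fun w => all (G w) R && (count (fun z => ~~ G w z) S <= 1)).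
Proof.
move=> RS S3; have := sum_nonadj (R ++ R ++ S); rewrite /many -/n.
set c := #|_|.
have : 2 * n <= 2 * c + \sum_w count (fun z => ~~ G w z) (R ++ R ++ S).
  have -> : n = \sum_(w : V) 1 by rewrite sum1_card.
  rewrite /c -sum1_card [X in 2 * X + _]big_mkcond !big_distrr -big_split;
    apply: leq_sum => w _ /=.
  rewrite unfold_in /= !count_cat; case: allP => /= [_|/allP]; first by
    case: (leqP (count _ S) 1) => /=; lia.
  rewrite -has_predC has_count -[count (predC _) _]/(count (fun z => ~~ G w z) R).
  by move: (count _ R) (count _ S) => a b; lia.
rewrite !size_cat addnA (_ : size R + size R + size S = size R + k.+1); last by rewrite -RS; lia.
move: (\sum_w _) (n) c (size R) (size S) RS S3 => s m c r t RS S3 h1 h2.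
have : (r + k.+1) * ((4 * k + 1) * m) <= (2 * k - 1) * ((4 * k + 1) * m) 
  by rewrite leq_mul2r; lia.
nia.
Qed.

(* [S] is what remains of the clique [S0] after [j] exchanges, [R] the new vertices. *)
Definition completes (S0 : seq V) j (R : seq V) : bool :=
  `[< exists S : seq V, [/\ {subset S <= S0}, size S + j = k.+1, size R = j &
    pairwise G (R ++ S)] >].

Lemma dense_completes S0 j : size S0 = k.+1 -> pairwise G S0 -> j < k ->
  dense (4 * k) j (completes S0 j).
Proof.
move=> sS pS; elim: j => [|j IH] jk /=.
  by apply/asboolP; exists S0; rewrite addn0; split.
apply: dense_mono (IH (ltnW jk)) => R /asboolP[S [SS0 sSj sR pRS]].
have RSk : size R + size S = k.+1 by rewrite sR addnC.
have S3 : 3 <= size S by lia.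
apply: many_mono (many_swaps RSk S3) => w /andP[wR wS].
apply/asboolP; exists (take (size S).-1 [seq z <- S | G w z]).
have sf : (size S).-1 <= size [seq z <- S | G w z].
  have := count_predC (G w) S; rewrite size_filter -[count (predC _) _]/(count (fun z =>
    ~~ G w z) S).
  rewrite -[count (fun z => G w z) S]/(count (G w) S).
  by move: wS; move: (count (fun z => ~~ G w z) S) (count (G w) S) => a b; lia.
have subS : subseq (take (size S).-1 [seq z <- S | G w z]) S.
  exact: subseq_trans (take_subseq _ _) (filter_subseq _ _).
split.
- by move=> z /(mem_subseq subS)/SS0.
- by rewrite size_takel //; lia.
- by rewrite size_rcons sR.
rewrite cat_rcons; move: pRS; rewrite !pairwise_cat /= => /and3P[aRS pR pS'].
rewrite pR (subseq_pairwise subS) // andbT.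
apply/andP; split; last first.
  by apply/allP => z /mem_take; rewrite mem_filter => /andP[].
apply/allrelP => a b aR; rewrite inE => /orP[/eqP ->|/(mem_subseq subS) bS].
  by rewrite sG; exact: (allP wR).
exact: (allrelP aRS).
Qed.

Definition joint (p : V * V) (s : seq V) :=
  [&& size s == k, pairwise G s, G p.1 p.2 &
      all (fun z => G p.1 z && G p.2 z) (take k.-1 s)].

Lemma dense_joint S0 : size S0 = k.+1 -> pairwise G S0 -> exists p,
  dense (4 * k * (k.+1 * k.+1)) k (joint p).
Proof.
move=> sS pS; have kk : k.-1 < k by lia.
have := dense_completes sS pS kk.
have V0 : 0 < #|V| by case: S0 sS {pS} => // v S0 _; apply/card_gt0P; exists v.
move=> h; have : dense (4 * k) k (fun s => has (joint^~ s) [seq (u, v) | u <- S0, v <- S0]).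
  rewrite -{2}(prednK (ltnW k_ge2)) /=; apply: dense_mono h => R /asboolP[S [SS0 sSj sR pRS]].
  have := many_common_nbrs sR; apply: many_mono => w wR.
  case: S sSj SS0 pRS => [|u [|v [|]]] /=; try lia.
  move=> _ SS0; rewrite pairwise_cat /= !andbT => /and3P[aR pR uv].
  apply/hasP; exists (u, v).
    by apply: allpairs_f; apply: SS0; rewrite !inE eqxx ?orbT.
  rewrite /joint /= size_rcons sR prednK ?(ltnW k_ge2) // eqxx pairwise_rcons pR uv.
  rewrite -cats1 take_cat sR ltnn subnn take0 cats0 andbT /=; apply/andP; split.
    by apply/allP => z zR; rewrite sG; exact: (allP wR).
  apply/allP => z zR; rewrite !(sG _ z).
  by rewrite !(allrelP aR) // !inE eqxx ?orbT.
move=> /(dense_has V0)[p _]; rewrite size_allpairs sS => hp; by exists p.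
Qed.

End Joints.

Lemma joint_blocks_Kplus n (G : rel 'I_n) k t (p : 'I_n * 'I_n) (A : 'I_t -> seq 'I_n) x0 :
  symmetric G -> irreflexive G -> 2 <= k -> 
  (forall i, joint G k p (A i)) ->
  (forall i j a b, a < k -> b < k -> a != b -> G (nth x0 (A i) a) (nth x0 (A j) b)) ->
  (forall a, a < k -> injective (fun i => nth x0 (A i) a)) ->
  contains_copy G (Kplus k t).
Proof.
case: p => u v sG iG k2 jA cA iA.
pose last_col := [seq nth x0 (A i) k.-1 | i <- enum 'I_t].
have kk : k.-1 < k by lia.
have [t0|t0] := posnP t.
  by subst t; exists (fun=> x0); split => [[a []]|[a []]].
have uv : G u v by have /and4P[] := jA (Ordinal t0).
pose B := u :: v :: [seq z <- last_col | (z != u) && (z != v)].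
have ul : uniq last_col by rewrite map_inj_uniq ?enum_uniq //; exact: iA.
have uB : uniq B.
  rewrite /= !inE !mem_filter !eqxx /= andbF orbF (filter_uniq _ ul) ?andbT /=.
  by apply/eqP => e; move: uv; rewrite e iG.
have sB : t <= size B.
  have sl : size last_col = t by rewrite size_map size_enum_ord.
  rewrite /= size_filter -{1}sl -(count_predC (fun z => (z != u) && (z != v))) -addn2 leq_add2l.
  have /eq_count -> : predC (fun z => (z != u) && (z != v)) =1 predU (pred1 u) (pred1 v).
    by move=> z /=; rewrite negb_and !negbK.
  apply: leq_trans (leq_addr (count (predI (pred1 u) (pred1 v)) last_col) _) _.
  by rewrite count_predUI !count_uniq_mem // (leq_add (leq_b1 _) (leq_b1 _)).
have adjB z i a : z \in B -> a < k.-1 -> G z (nth x0 (A i) a).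
  move=> zB ak; have /and4P[/eqP sA _ _ /allP hA] := jA i.
  have : nth x0 (A i) a \in take k.-1 (A i).
    by rewrite -(nth_take x0 ak) mem_nth // size_takel // sA; lia.
  move=> /hA /andP[hu hv].
  move: zB; rewrite !inE => /or3P[/eqP ->//|/eqP -> //|].
  rewrite mem_filter => /andP[_ /mapP[j _ ->]]; apply: cA => //; last by lia.
  exact: leq_trans ak (leq_pred _).
pose f (x : 'I_k * 'I_t) := if val x.1 == 0 then nth x0 B x.2 else nth x0 (A x.2) (val x.1).-1.
have memB (i : 'I_t) : nth x0 B i \in B by apply: mem_nth; exact: leq_trans sB.
have adj x y : x.1 != y.1 -> G (f x) (f y).
  case: x y => [a i] [b j] /= ab; rewrite /f /=.
  have pk (c : 'I_k) : val c != 0 -> (val c).-1 < k.-1 by have := ltn_ord c; rewrite /=; lia.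
  case: eqP => a0; case: eqP => b0.
  - by case/eqP: ab; apply: val_inj; exact: etrans a0 (esym b0).
  - by apply: adjB => //; apply: pk; exact/eqP.
  - by rewrite sG; apply: adjB => //; apply: pk; exact/eqP.
  apply: cA; [have := ltn_ord a; rewrite /=; lia|have := ltn_ord b; rewrite /=; lia|].
  by move: ab; rewrite -val_eqE /=; move/eqP: a0; move/eqP: b0; rewrite /=; lia.
exists f; split.
  move=> x y fxy; have [e|ne] := eqVneq x.1 y.1; last first.
    by have := adj _ _ ne; rewrite fxy iG.
  case: x y e fxy => [a i] [b j] /= <-; rewrite /f /=; case: eqP => a0 h.
    congr (_, _); apply: val_inj; apply/eqP.
    by rewrite -(nth_uniq x0 _ _ uB) ?h // (leq_trans (ltn_ord _) sB).
  congr (_, _); apply: iA h; have := ltn_ord a; rewrite /=; lia.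
move=> [a i] [b j] /orP[/adj //|] /and3P[/= /eqP a0 /eqP b0]; rewrite /f /= a0 b0 /=.
by case/orP => /andP[/eqP -> /eqP ->] //=; rewrite sG.
Qed.

Local Open Scope ring_scope.

(** * The signless Laplacian form *)

Section SignlessForm.
Variables (R : realType) (n : nat).
Implicit Types (G : rel 'I_n) (x y d : 'I_n -> R).

Definition qform G y : R := \sum_i \sum_j (G i j)%:R * (y i + y j) ^+ 2.

Lemma formD G x d t :
  qform G (fun i => x i + t * d i) = qform G x +
    2 * t * (\sum_i \sum_j (G i j)%:R * ((x i + x j) * (d i + d j))) +
    t ^+ 2 * qform G d.
Proof.
rewrite /qform !mulr_sumr -!big_split; apply: eq_bigr => i _ /=.
rewrite !mulr_sumr -!big_split; apply: eq_bigr => j _ /=; ring.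
Qed.

Lemma sym_pairing G x d : symmetric G ->
  \sum_i \sum_j (G i j)%:R * ((x i + x j) * (d i + d j)) =
  2 * \sum_i d i * \sum_j (G i j)%:R * (x i + x j).
Proof.
move=> sG.
transitivity (\sum_i \sum_j d i * ((G i j)%:R * (x i + x j)) +
              \sum_i \sum_j d j * ((G i j)%:R * (x i + x j))).
  rewrite -!big_split; apply: eq_bigr => i _ /=.
  rewrite -!big_split; apply: eq_bigr => j _ /=; ring.
rewrite [X in _ + X]exchange_big /= mulr2n mulrDl !mul1r; congr (_ + _).
  by apply: eq_bigr => i _; rewrite mulr_sumr.
apply: eq_bigr => i _; rewrite mulr_sumr; apply: eq_bigr => j _.
by rewrite sG [x j + _]addrC.
Qed.

Lemma form_pairing G y : symmetric G ->
  qform G y = 2 * \sum_i y i * \sum_j (G i j)%:R * (y i + y j).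
Proof.
move=> sG; rewrite -sym_pairing //; apply: eq_bigr => i _.
Qed.

Lemma formZ G a y : qform G (fun i => a * y i) = a ^+ 2 * qform G y.
Proof.
rewrite /qform mulr_sumr; apply: eq_bigr => i _.
rewrite mulr_sumr; apply: eq_bigr => j _; ring.
Qed.

Lemma form_abs G y : qform G y <= qform G (fun i => `|y i|).
Proof.
apply: ler_sum => i _; apply: ler_sum => j _; apply: ler_wpM2l => //.
by rewrite -[leLHS]real_normK ?num_real // lerXn2r ?nnegrE ?addr_ge0 // ler_normD.
Qed.

Lemma linear_le0_eq0 (a b : R) : (forall t, a * t + b * t ^+ 2 <= 0) -> a = 0.
Proof.
move=> H; have := H (a / (`|b| + 1)).
set c := _ + 1; have c0 : 0 < c by rewrite ltr_pwDr.
have -> : a * (a / c) + b * (a / c) ^+ 2 = (a / c) ^+ 2 * (c + b).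
  by field; rewrite gt_eqF.
have cb : 0 < c + b by rewrite /c; have := ler_norm (- b); rewrite normrN; lra.
rewrite pmulr_lle0 // => h; have := sqr_ge0 (a / c).
move=> h2; have /eqP : (a / c) ^+ 2 = 0 by apply/eqP; rewrite eq_le h h2.
by rewrite expf_eq0 /= mulf_eq0 invr_eq0 (gt_eqF c0) orbF => /eqP.
Qed.

Lemma form_max G : (0 < n)%N -> exists c, \sum_i c i ^+ 2 = 1 /\
  forall y, qform G y <= qform G c * \sum_i y i ^+ 2.
Proof.
move=> n0.
pose N (v : 'rV[R]_n) : R := \sum_i v 0 i ^+ 2.
pose A := [set v | N v = 1]%classic.
have cN : continuous N.
  apply: continuous_big => [|i _ v]; first exact: add_continuous.
  apply: (continuous_comp (g := fun x : R => x ^+ 2)); first exact: coord_continuous.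
  exact: exprn_continuous.
pose F (v : 'rV[R]_n) := qform G (v 0).
have cF : continuous F.
  apply: continuous_big => [|i _]; first exact: add_continuous.
  apply: continuous_big => [|j _ v]; first exact: add_continuous.
  apply: (@continuousM _ _ (fun=> (G i j)%:R) (fun v : 'rV[R]_n => (v 0 i + v 0 j) ^+ 2)).
    exact: cst_continuous.
  apply: (continuous_comp (g := fun x : R => x ^+ 2)); last exact: exprn_continuous.
  apply: (@continuousD _ _ _ (fun v : 'rV[R]_n => v 0 i) (fun v : 'rV[R]_n => v 0 j));
    exact: coord_continuous.
have A0 : (A !=set0)%classic.
  exists (delta_mx 0 (Ordinal n0)); rewrite /A /N /=.
  rewrite (bigD1 (Ordinal n0)) //= big1 ?addr0 ?mxE ?eqxx ?expr1n // => i ni.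
  by rewrite mxE (negbTE ni) andbF expr0n.
have cA : compact A.
  apply: bounded_closed_compact.
    exists 1; split; first exact: num_real.
    move=> M M1 v Av; rewrite /= [leLHS]/Num.norm /= mx_normrE.
    apply/bigmax_leP; split=> [|[a i] _ /=]; first by rewrite (le_trans ler01) ?ltW.
    rewrite ord1 (le_trans _ (ltW M1)) // -(@expr_le1 _ 2) // real_normK ?num_real //.
    rewrite -Av /N (bigD1 i) //= lerDl sumr_ge0 // => j _; exact: sqr_ge0.
  by have /continuous_closedP cl := cN; exact: (cl _ (@closed_eq _ 1)).
have [c cAA cmax] := compact_EVT_max A0 cA (continuous_subspaceT cF).
exists (c 0); split; first by move: cAA; rewrite inE.
move=> y; set s := \sum_i y i ^+ 2.
have s0 : 0 <= s by apply: sumr_ge0 => i _; exact: sqr_ge0.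
have [s1|s1] := eqVneq s 0.
  have y0 i : y i = 0.
    apply/eqP; rewrite -sqrf_eq0 eq_le sqr_ge0 andbT -s1 /s (bigD1 i) //=.
    by rewrite lerDl sumr_ge0 // => j _; exact: sqr_ge0.
  rewrite s1 mulr0 /qform big1 // => i _; rewrite big1 // => j _.
  by rewrite !y0 addr0 expr0n mulr0.
have sp : 0 < s by rewrite lt_neqAle eq_sym s1.
have sq : (Num.sqrt s)^-1 ^+ 2 = s^-1 by rewrite exprVn sqr_sqrtr.
have := cmax (\row_i ((Num.sqrt s)^-1 * y i)).
have -> : F (\row_i ((Num.sqrt s)^-1 * y i)) = s^-1 * qform G y.
  rewrite -sq -formZ /F; congr qform; apply/funext => i; by rewrite mxE.
rewrite mulrC ler_pdivrMr //; apply; rewrite inE /A /N /=.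
under eq_bigr do rewrite mxE exprMn sq.
by rewrite -mulr_sumr mulVf.
Qed.

Lemma form_perron G : (0 < n)%N -> symmetric G -> exists x : 'I_n -> R, exists l : R,
  [/\ forall i, 0 <= x i, \sum_i x i ^+ 2 = 1,
    forall i, \sum_j (G i j)%:R * (x i + x j) = l * x i &
    forall y, qform G y <= 2 * l * \sum_i y i ^+ 2].
Proof.
move=> n0 sG; have [c [c1 cmax]] := form_max G n0.
pose x (i : 'I_n) : R := `|c i|.
have x1 : \sum_i x i ^+ 2 = 1.
  by rewrite -c1; apply: eq_bigr => i _; rewrite real_normK ?num_real.
have xmax : qform G x = qform G c.
  apply/eqP; rewrite eq_le form_abs andbT.
  by have := cmax x; rewrite x1 mulr1.
exists x, (qform G c / 2); split => [i| | |] //; first exact: normr_ge0; last by move=> y;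
  rewrite [2 * _]mulrCA divff ?mulr1 ?pnatr_eq0.
move=> k; pose d (i : 'I_n) : R := (i == k)%:R.
have sd (z : 'I_n -> R) : \sum_i d i * z i = z k.
  rewrite (bigD1 k) //= /d eqxx mul1r big1 ?addr0 // => i /negbTE ->.
  by rewrite mul0r.
have d2 : \sum_i d i ^+ 2 = 1.
  by under eq_bigr do rewrite expr2; rewrite sd /d eqxx.
apply/eqP; rewrite -subr_eq0; apply/eqP.
apply: (@linear_le0_eq0 _ ((qform G d - qform G c) / 4)) => t.
have := cmax (fun i => x i + t * d i).
rewrite formD sym_pairing // sd xmax.
have -> : \sum_i (x i + t * d i) ^+ 2 = 1 + 2 * t * x k + t ^+ 2.
  transitivity (\sum_i x i ^+ 2 + 2 * t * (\sum_i d i * x i) + t ^+ 2 * \sum_i d i ^+ 2).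
    rewrite !mulr_sumr -!big_split /=; apply: eq_bigr => i _; ring.
  by rewrite x1 sd d2 mulr1.
nra.
Qed.

Lemma deg_sum G i : deg G i = (\sum_j G i j)%N.
Proof.
rewrite /deg -sum1_card big_mkcond /=; apply: eq_bigr => j _.
have -> : (j \in [set j | G i j]%classic) = G i j by apply/idP/idP; rewrite inE.
by case: (G i j).
Qed.

Lemma signless_eigen G (v : 'rV[R]_n) l : symmetric G ->
  v *m signless_laplacian R G = l *: v <->
  forall i, \sum_j (G i j)%:R * (v 0 i + v 0 j) = l * v 0 i.
Proof.
move=> sG.
have E i : (v *m signless_laplacian R G) 0 i = \sum_j (G i j)%:R * (v 0 i + v 0 j).
  rewrite mxE; under eq_bigr do rewrite !mxE mulrDr.
  rewrite big_split /= (bigD1 i) //= eqxx mul1r big1 ?addr0; last first.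
    by move=> j /negbTE ->; rewrite mul0r mulr0.
  under [RHS]eq_bigr do rewrite mulrDr.
  rewrite [RHS]big_split /=; congr (_ + _).
    by rewrite -mulr_suml mulrC deg_sum natr_sum.
  by apply: eq_bigr => j _; rewrite sG mulrC.
split=> [h i|h]; first by rewrite -E h mxE.
by apply/rowP => i; rewrite E h mxE.
Qed.

Definition perron_vector G (x : 'I_n -> R) := [/\ forall i, 0 <= x i, \sum_i x i ^+ 2 = 1 &
    forall i, \sum_j (G i j)%:R * (x i + x j) = q R n G * x i].

Lemma perron_spec G : (0 < n)%N -> symmetric G ->
  (exists x, perron_vector G x) /\
  forall y, qform G y <= 2 * q R n G * \sum_i y i ^+ 2.
Proof.
move=> n0 sG; have [x [l [x0 x1 xe lmax]]] := form_perron n0 sG.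
suff ql : q R n G = l by rewrite /perron_vector ql; split => //; exists x.
have xl : eigenvalue (signless_laplacian R G) l.
  apply/eigenvalueP; exists (\row_i x i).
    by apply/(signless_eigen _ _ sG) => i; under eq_bigr do rewrite !mxE; rewrite xe mxE.
  apply/eqP => /rowP h; have /eqP := x1; rewrite big1 ?(eq_sym 0) ?oner_eq0 // => i _.
  by have := h i; rewrite !mxE => ->; rewrite expr0n.
have ubl : ubound [set m : R | eigenvalue (signless_laplacian R G) m] l.
  move=> m /= /eigenvalueP[v /(signless_eigen _ _ sG) ve v0].
  have := lmax (v 0); rewrite form_pairing //.
  under eq_bigr do rewrite ve mulrCA -expr2.
  rewrite -mulr_sumr mulrA ler_pM2r.
    by rewrite ler_pM2l.
  rewrite lt_neqAle sumr_ge0 ?andbT => [|i _]; last exact: sqr_ge0.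
  apply: contraNneq v0 => /esym/eqP; rewrite psumr_eq0 => [/allP h|i _]; last exact: sqr_ge0.
  apply/eqP/rowP => i; rewrite mxE; apply/eqP.
  by have := h i (mem_index_enum _); rewrite sqrf_eq0.
apply/eqP; rewrite eq_le; apply/andP; split.
  by apply: ge_sup => //; exists l.
by apply: ub_le_sup => //; exists l.
Qed.

End SignlessForm.

(** * The spectral Turan theorem *)

Definition pullback (m n : nat) (r : 'I_m -> 'I_n) (G : rel 'I_n) : rel 'I_m :=
  fun i j => G (r i) (r j).

Lemma pullback_simple m n (r : 'I_m -> 'I_n) G :
  simple_graph G -> simple_graph (pullback r G).
Proof.
move=> [sG iG]; split=> [i j|i]; rewrite /pullback; [exact: sG|exact: iG].
Qed.

Section Zykov.
Variables (R : realType) (n : nat) (G : rel 'I_n).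
Hypotheses (n_gt0 : (0 < n)%N) (gG : simple_graph G).
Hypothesis maxG : forall r : 'I_n -> 'I_n, q R n (pullback r G) <= q R n G.
Hypothesis q_gt : n%:R - 1 < q R n G.
Variable x : 'I_n -> R.
Hypothesis px : perron_vector G x.

Let sG : symmetric G := proj1 gG.
Let W i j : R := (G i j)%:R * (x i + x j) ^+ 2.
Let g i : R := \sum_j (G i j)%:R * ((x i + x j) * x j).

Lemma sum_W i : \sum_j W i j = q R n G * x i ^+ 2 + g i.
Proof.
have [_ _ e] := px; rewrite expr2 mulrA -e mulr_suml -big_split /=.
apply: eq_bigr => j _; rewrite /W; ring.
Qed.

Lemma W_sym i j : W i j = W j i.
Proof. by rewrite /W sG addrC. Qed.

Lemma W_nonadj i j : ~~ G i j -> W i j = 0.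
Proof. by rewrite /W => /negbTE ->; rewrite mul0r. Qed.

Lemma perron_form : qform G x = 2 * q R n G.
Proof.
have [_ x1 e] := px; rewrite form_pairing //; congr (2 * _).
under eq_bigr do rewrite e mulrCA -expr2.
by rewrite -mulr_sumr x1 mulr1.
Qed.

Lemma pullback_max (r : 'I_n -> 'I_n) :
  \sum_i \sum_j W (r i) (r j) <= 2 * q R n G * \sum_i x (r i) ^+ 2.
Proof.
have [_ h] := perron_spec R n_gt0 (proj1 (pullback_simple r gG)).
apply: le_trans (h (fun i => x (r i))) _.
apply: ler_wpM2r; first by apply: sumr_ge0 => i _; exact: sqr_ge0.
by apply: ler_wpM2l.
Qed.

Definition merge_into (A : pred 'I_n) u i := if A i then u else i.

Lemma sum_merge1 v u (F : 'I_n -> R) :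
  \sum_i F (merge_into (pred1 v) u i) = \sum_i F i + F u - F v.
Proof.
rewrite [LHS](bigD1 v) //= [X in _ = X + _ - _](bigD1 v) //= /merge_into /= eqxx.
under eq_bigr => i /negbTE -> do [].
ring.
Qed.

Lemma sum_merge2 u w v (F : 'I_n -> R) : u != w ->
  \sum_i F (merge_into (pred2 u w) v i) = \sum_i F i + 2 * F v - F u - F w.
Proof.
move=> uw; have wu : w != u by rewrite eq_sym.
rewrite [LHS](bigD1 u) // [X in _ + X = _](bigD1 w) //.
rewrite [X in _ = X + _ - _ - _](bigD1 u) // [X in _ = _ + X + _ - _ - _](bigD1 w) //=.
rewrite /merge_into /= !eqxx orbT /=.
under eq_bigr => i /andP[/negbTE -> /negbTE ->] do [].
rewrite /=; ring.
Qed.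

Lemma nonadj_le u v : ~~ G u v -> g u <= g v.
Proof.
move=> uv; have := pullback_max (merge_into (pred1 v) u).
under eq_bigr do rewrite sum_merge1.
rewrite (sum_merge1 v u (fun i => \sum_j W i j + W i u - W i v)).
rewrite (sum_merge1 v u (fun i => x i ^+ 2)).
have [_ -> _] := px.
rewrite !big_split /= sumrN.
have -> : \sum_i \sum_j W i j = 2 * q R n G by rewrite -perron_form.
under [\sum_(i < n) W i u]eq_bigr do rewrite W_sym.
under [\sum_(i < n) W i v]eq_bigr do rewrite W_sym.
rewrite !sum_W (W_sym v u) (W_nonadj uv) !W_nonadj ?(proj2 gG) //.
nra.
Qed.

Lemma nonadj_eq u v : ~~ G u v -> g u = g v.
Proof. by move=> uv; apply/eqP; rewrite eq_le !nonadj_le // sG. Qed.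

Lemma perron_gt0 u : 0 < x u.
Proof.
have [x0 x1 e] := px; rewrite lt_neqAle x0 andbT eq_sym; apply/negP => /eqP xu.
have nb j : G u j -> x j = 0.
  move=> uj; have := e u; rewrite xu mulr0 => /eqP.
  rewrite psumr_eq0 => [/allP /(_ j (mem_index_enum _))|i _].
    by rewrite uj mul1r add0r => /eqP.
  by rewrite mulr_ge0 // add0r.
have gu : g u = 0.
  rewrite /g big1 // => j _; case uj: (G u j); last by rewrite mul0r.
  by rewrite (nb j uj) !mulr0.
have [v xv] : exists v, x v != 0.
  apply/existsP; rewrite -negb_forall; apply/negP => /forallP h.
  have /eqP := x1; rewrite big1 ?(eq_sym 0) ?oner_eq0 // => i _.
  by rewrite (eqP (h i)) expr0n.
have uv : ~~ G u v by apply: contra xv => /nb ->.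
have /esym/eqP := nonadj_eq uv; rewrite gu psumr_eq0 => [|j _]; last first.
  by rewrite !mulr_ge0 // addr_ge0.
move=> /allP h; have xvp : 0 < x v by rewrite lt_neqAle eq_sym xv x0.
have nv j : G v j -> x j = 0.
  move=> vj; have := h j (mem_index_enum _); rewrite vj mul1r mulf_eq0.
  by rewrite gt_eqF ?ltr_pwDl //= => /eqP.
have := e v; under eq_bigr => j _.
  have -> : (G v j)%:R * (x v + x j) = (G v j)%:R * x v.
    by case vj: (G v j); rewrite ?mul0r // (nv j vj) addr0.
  over.
rewrite -mulr_suml -natr_sum -deg_sum => /(mulIf (lt0r_neq0 xvp)) dv.
move: q_gt; rewrite -dv ltrBlDr -(natrD _ _ 1) ltr_nat addn1 ltnS leqNgt.
suff -> : (deg G v < n)%N by [].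
rewrite deg_sum (bigD1 v) //= (proj2 gG) add0n.
apply: leq_ltn_trans (_ : \sum_(i < n | i != v) 1 < _)%N.
  by apply: leq_sum => i _; exact: leq_b1.
by rewrite sum1_card cardC1 card_ord prednK.
Qed.

Lemma nonadj_trans v u w : ~~ G u v -> ~~ G v w -> ~~ G u w.
Proof.
move=> uv vw; apply/negP => uw.
have nuw : u != w by apply/eqP => e; move: uw; rewrite e (proj2 gG).
have := pullback_max (merge_into (pred2 u w) v).
under eq_bigr do rewrite sum_merge2 //.
rewrite (sum_merge2 v (fun i => \sum_j W i j + 2 * W i v - W i u - W i w)) //.
rewrite (sum_merge2 v (fun i => x i ^+ 2)) //.
have [_ -> _] := px.
rewrite !big_split /= !sumrN -mulr_sumr.
have -> : \sum_i \sum_j W i j = 2 * q R n G by rewrite -perron_form.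
have -> : \sum_i W i v = \sum_i W v i by apply: eq_bigr => i _; rewrite W_sym.
have -> : \sum_i W i u = \sum_i W u i by apply: eq_bigr => i _; rewrite W_sym.
have -> : \sum_i W i w = \sum_i W w i by apply: eq_bigr => i _; rewrite W_sym.
rewrite !sum_W (W_sym v u) (W_nonadj uv) (W_sym w v) (W_nonadj vw) (W_sym w u).
have Wii i : W i i = 0 by rewrite W_nonadj // (proj2 gG).
rewrite !Wii (nonadj_eq uv) -(nonadj_eq vw).
have : 0 < W u w.
  by rewrite /W uw mul1r exprn_gt0 // addr_gt0 ?perron_gt0.
nra.
Qed.

End Zykov.

Definition clique_free k n (G : rel 'I_n) :=
  forall s : seq 'I_n, size s = k.+1 -> ~~ pairwise G s.

Lemma pullback_clique_free k m n (r : 'I_m -> 'I_n) (G : rel 'I_n) :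
  clique_free k G -> clique_free k (pullback r G).
Proof.
move=> fG s ss; have := fG (map r s); rewrite size_map => /(_ ss).
by rewrite pairwise_map.
Qed.

Definition coloured k n (f : 'I_n -> 'I_k) : rel 'I_n := fun i j => f i != f j.

Lemma coloured_simple k n (f : 'I_n -> 'I_k) : simple_graph (coloured f).
Proof. by split=> [i j|i]; rewrite /coloured ?eqxx // eq_sym. Qed.

(* Colour classes are the classes of non-adjacency, indexed by their
   canonical representatives. *)
Lemma multipartite_coloured k n (G : rel 'I_n) : simple_graph G -> clique_free k G ->
  (forall v u w, ~~ G u v -> ~~ G v w -> ~~ G u w) ->
  exists f : 'I_n -> 'I_k, G =2 coloured f.
Proof.
move=> [sG iG] fG tG.
pose rep i := odflt i [pick j | ~~ G i j].
have repP i : ~~ G i (rep i).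
  by rewrite /rep; case: pickP => [j //|/(_ i)]; rewrite iG.
have repV i : ~~ G (rep i) i by rewrite sG.
have rep_eq i j : ~~ G i j -> rep i = rep j.
  move=> ij; rewrite /rep.
  have -> : [pick l | ~~ G i l] = [pick l | ~~ G j l].
    apply: eq_pick => l /=; apply/idP/idP => h; last exact: (tG _ _ _ ij).
    by apply: (tG _ _ _ _ h); rewrite sG.
  by case: pickP => // /(_ j); rewrite iG.
pose S := [set rep i | i in 'I_n]%SET.
have Sk : (#|S| <= k)%N.
  rewrite leqNgt; apply/negP => kS.
  have := fG (take k.+1 (enum S)); rewrite size_takel -?cardE // => /(_ erefl) /negP; apply.
  have : uniq (take k.+1 (enum S)) by rewrite take_uniq ?enum_uniq.
  rewrite uniq_pairwise; apply: sub_in_pairwise (_ : all (mem S) _) => [a b|].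
    move=> /imsetP[i _ ->] /imsetP[j _ ->] /= ne; apply/negPn/negP => h.
    case/eqP: ne; exact: rep_eq (tG _ _ _ (repP i) (tG _ _ _ h (repV j))).
  by apply/allP => z /mem_take; rewrite mem_enum.
have rS i : rep i \in S by apply: imset_f.
have h i : (index (rep i) (enum S) < k)%N.
  by apply: leq_trans Sk; rewrite cardE index_mem mem_enum.
exists (fun i => Ordinal (h i)) => i j; rewrite /coloured -val_eqE /=.
apply/idP/idP => [ij|/eqP ne]; last first.
  by apply/negPn/negP => ij; apply: ne; rewrite (rep_eq _ _ ij).
apply/eqP => e; have re : rep i = rep j.
  by rewrite -[LHS](@nth_index _ i _ (enum S)) ?mem_enum // e nth_index ?mem_enum.
by have := repV j; rewrite -re => /(tG _ _ _ (repP i)); rewrite ij.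
Qed.

Lemma q_lower (R : realType) n (G : rel 'I_n) (y : 'I_n -> R) (l : R) :
  simple_graph G -> 0 < \sum_i y i ^+ 2 -> 2 * l * \sum_i y i ^+ 2 <= qform G y -> l <= q R n G.
Proof.
move=> gG y0 h; have n0 : (0 < n)%N.
  by case: n G y gG y0 h => [|//] G y _; rewrite big_ord0 ltxx.
have [_ /(_ y) h2] := perron_spec R n0 (proj1 gG).
have := le_trans h h2; rewrite ler_pM2r // ler_pM2l //.
Qed.

Lemma q_pullback_bij (R : realType) n (G : rel 'I_n) (f : 'I_n -> 'I_n) :
  (0 < n)%N -> simple_graph G -> bijective f -> q R n (pullback f G) = q R n G.
Proof.
move=> n0 gG bf.
have le (H : rel 'I_n) h : simple_graph H -> bijective h -> q R n H <= q R n (pullback h H).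
  move=> gH bh; have [[x px] _] := perron_spec R n0 (proj1 gH).
  have x1 : \sum_i x (h i) ^+ 2 = 1.
    by have [_ <- _] := px; rewrite [RHS](reindex h) //; exact: onW_bij.
  apply: (@q_lower _ _ _ (fun i => x (h i))); rewrite ?x1 ?ltr01 //.
    exact: pullback_simple.
  rewrite mulr1 -(perron_form gH px) /qform [leLHS](reindex h) /=; last exact: onW_bij.
  apply: ler_sum => i _; rewrite [leLHS](reindex h) //=; exact: onW_bij.
have [f' fK Kf] := bf.
have bf' : bijective f' by exists f.
apply: le_anti; apply/andP; split; last exact: le.
suff {2}-> : G = pullback f' (pullback f G) by apply: le => //; exact: pullback_simple.
by apply/funext => i; apply/funext => j; rewrite /pullback !Kf.
Qed.

Definition colour_size k n (f : 'I_n -> 'I_k) c : nat := (\sum_i (f i == c))%N.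

Lemma sum_colour_size k n (f : 'I_n -> 'I_k) : (\sum_c colour_size f c)%N = n.
Proof.
rewrite exchange_big /= -[RHS]card_ord -sum1_card; apply: eq_bigr => i _.
by rewrite (bigD1 (f i)) //= eqxx big1 // => c /negbTE; rewrite eq_sym => ->.
Qed.

Section ColouredSpectrum.
Variables (R : realType) (k n : nat).
Implicit Types f : 'I_n -> 'I_k.

Lemma sum_same_colour f (y : 'I_n -> R) c :
  \sum_(i | f i == c) y i = \sum_i (f i == c)%:R * y i.
Proof.
rewrite big_mkcond; apply: eq_bigr => i _; case: ifP; by rewrite ?mul1r ?mul0r.
Qed.

Lemma sum_by_colour f (y : 'I_n -> R) : \sum_c \sum_(i | f i == c) y i = \sum_i y i.
Proof. by rewrite (partition_big f xpredT). Qed.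

Lemma colour_sizeE f c : (colour_size f c)%:R = \sum_(i | f i == c) 1 :> R.
Proof. by rewrite sum_same_colour natr_sum; apply: eq_bigr => i _; rewrite mulr1. Qed.

(* Summing the eigenvalue equation over a colour class of size [s] gives
   the share [s / (q - n + 2 s)] of the total weight. *)
Lemma coloured_shares f : (0 < n)%N -> n%:R < q R n (coloured f) ->
  \sum_c (colour_size f c)%:R / (q R n (coloured f) - n%:R + 2 * (colour_size f c)%:R) = 1 :> R.
Proof.
move=> n0; set l := q _ _ _ => ln.
have [[x [x0 x1 e]] _] := perron_spec R n0 (proj1 (coloured_simple f)).
set S := \sum_i x i; pose Sc c := \sum_(i | f i == c) x i.
have S0 : 0 < S.
  rewrite lt_neqAle sumr_ge0 // andbT eq_sym psumr_eq0 //; apply/negP => /allP h.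
  have /eqP := x1; rewrite big1 ?(eq_sym 0) ?oner_eq0 // => i _.
  by rewrite (eqP (h i (mem_index_enum _))) expr0n.
have ev i : (n%:R - (colour_size f (f i))%:R) * x i + (S - Sc (f i)) = l * x i.
  rewrite -e /coloured.
  have E j : (f i != f j)%:R * (x i + x j) =
     1 * x i + x j - (1 * x i * (f j == f i)%:R + (f j == f i)%:R * x j) :> R.
    by rewrite (eq_sym (f i)); case: (f j == f i) => /=; ring.
  under eq_bigr do rewrite E.
  rewrite sumrB !big_split /= -mulr_suml -mulr_sumr sumr_const card_ord.
  rewrite -natr_sum -/(colour_size f (f i)) /Sc sum_same_colour -/S; ring.
have share c : Sc c * (l - n%:R + 2 * (colour_size f c)%:R) = (colour_size f c)%:R * S.
  have : \sum_(i | f i == c) ((n%:R - (colour_size f c)%:R) * x i + (S - Sc c) * 1)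
         = \sum_(i | f i == c) l * x i.
    by apply: eq_bigr => i /eqP <-; rewrite mulr1 ev.
  rewrite big_split /= -!mulr_sumr -colour_sizeE -/(Sc c); lra.
apply: (mulIf (lt0r_neq0 S0)); rewrite mul1r mulr_suml -[RHS](sum_by_colour f).
apply: eq_bigr => c _; rewrite mulrAC -share mulfK // gt_eqF //.
by have := ler0n R (colour_size f c); lra.
Qed.

Lemma coloured_q_le f : (0 < n)%N -> (0 < k)%N -> n%:R < q R n (coloured f) ->
  q R n (coloured f) <= 2 * (1 - k%:R^-1) * n%:R.
Proof.
move=> n0 k0 ln; have := coloured_shares n0 ln; set l := q _ _ _ in ln *.
set p := l - n%:R; have p0 : 0 < p by rewrite subr_gt0.
set s0 : R := n%:R / k%:R; have k0r : 0 < k%:R :> R by rewrite ltr0n.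
have s00 : 0 < s0 by rewrite divr_gt0 // ltr0n.
have ks : k%:R * s0 = n%:R by rewrite /s0 mulrC divfK ?gt_eqF.
have tangent s : 0 <= s -> s / (p + 2 * s) <=
  s0 / (p + 2 * s0) + (s - s0) * (p / (p + 2 * s0) ^+ 2).
  move=> s_ge0; rewrite -subr_ge0.
  have -> : s0 / (p + 2 * s0) + (s - s0) * (p / (p + 2 * s0) ^+ 2) - s / (p + 2 * s) =
     2 * p * (s - s0) ^+ 2 / ((p + 2 * s0) ^+ 2 * (p + 2 * s)).
    by field; rewrite !gt_eqF //; lra.
  apply: divr_ge0; apply: mulr_ge0; rewrite ?sqr_ge0 //; lra.
move=> h; have : 1 <= \sum_(c < k) (s0 / (p + 2 * s0) + ((colour_size f c)%:R - s0) * (p / (p +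
  2 * s0) ^+ 2)).
  by rewrite -[leLHS]h; apply: ler_sum => c _; apply: tangent; rewrite ler0n.
rewrite big_split /= sumr_const card_ord -mulr_suml sumrB sumr_const card_ord -natr_sum
  sum_colour_size.
have sk : s0 *+ k = n%:R by rewrite -ks mulr_natl.
rewrite -mulrnAl sk subrr mul0r addr0 ler_pdivlMr ?mul1r; last by lra.
move=> h2; have -> : 2 * (1 - k%:R^-1) * n%:R = 2 * (n%:R - s0) by rewrite /s0; ring.
rewrite /p in h2; lra.
Qed.

Lemma coloured_q_ge f b : (0 < n)%N -> (0 < k)%N ->
  (forall c, (b <= colour_size f c <= b.+1)%N) ->
  2 * (1 - k%:R^-1) * n%:R - 2 * k%:R / n%:R <= q R n (coloured f).
Proof.
move=> n0 k0 hb; have n0r : 0 < n%:R :> R by rewrite ltr0n.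
have k0r : 0 < k%:R :> R by rewrite ltr0n.
have s1 : \sum_(i < n) (1 : R) ^+ 2 = n%:R by under eq_bigr do rewrite expr1n;
  rewrite sumr_const card_ord.
apply: (@q_lower R n _ (fun=> 1)); rewrite ?s1 //; first exact: coloured_simple.
have -> : qform (coloured f) (fun=> 1 : R) = 4 * (n%:R ^+ 2 - \sum_c (colour_size f c)%:R ^+ 2).
  have -> : \sum_c (colour_size f c)%:R ^+ 2 = \sum_i \sum_j (f j == f i)%:R :> R.
    rewrite -(sum_by_colour f); apply: eq_bigr => c _.
    rewrite expr2 {1}colour_sizeE mulr_suml; apply: eq_bigr => i /eqP <-.
    by rewrite mul1r natr_sum.
  have -> : n%:R ^+ 2 = \sum_(i < n) \sum_(j < n) 1 :> R.
    by rewrite !sumr_const !card_ord expr2 -natrM mulrnA.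
  rewrite -sumrB mulr_sumr; apply: eq_bigr => i _; rewrite -sumrB mulr_sumr.
  by apply: eq_bigr => j _; rewrite /coloured eq_sym; case: eqP => /= _; ring.
set s0 : R := n%:R / k%:R.
have ks : k%:R * s0 = n%:R by rewrite /s0 mulrC divfK ?gt_eqF.
have bs : b%:R <= s0 <= b%:R + 1.
  have E a : (\sum_(c < k) a = a * k)%N by rewrite sum_nat_const card_ord mulnC.
  rewrite /s0 ler_pdivlMr // ler_pdivrMr // natr1 -!natrM !ler_nat.
  rewrite -!E -(sum_colour_size f).
  by apply/andP; split; apply: leq_sum => c _; have /andP[] := hb c.
have : \sum_c ((colour_size f c)%:R - s0) ^+ 2 <= \sum_(c < k) 1 :> R.
  apply: ler_sum => c _; have /andP[h1 h2] := hb c.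
  move: h1 h2; rewrite -!(ler_nat R) -addn1 natrD => h1 h2; nra.
have -> : \sum_c ((colour_size f c)%:R - s0) ^+ 2 = \sum_c (colour_size f c)%:R ^+ 2 - n%:R * s0.
  have E c : ((colour_size f c)%:R - s0) ^+ 2 =
    (colour_size f c)%:R ^+ 2 - 2 * s0 * (colour_size f c)%:R + s0 ^+ 2 by ring.
  under eq_bigr do rewrite E.
  rewrite big_split /= sumrB sumr_const card_ord -mulr_sumr -natr_sum sum_colour_size.
  by rewrite -mulr_natl -ks; ring.
rewrite sumr_const card_ord => h.
have -> : 2 * (2 * (1 - k%:R^-1) * n%:R - 2 * k%:R / n%:R) * n%:R =
  4 * (n%:R ^+ 2 - n%:R * s0 - k%:R).
  by rewrite /s0; field; rewrite !gt_eqF.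
lra.
Qed.

End ColouredSpectrum.

Section Balanced.
Variables (R : realType) (k n : nat).
Implicit Types f g : 'I_n -> 'I_k.

(* The share [s / (p + 2 s)] is strictly concave in [s], so on the integers it
   lies below the chord through [b] and [b + 1]. *)
Lemma share_chord (p : R) (b s : nat) : 0 < p ->
  let psi (s : nat) := s%:R / (p + 2 * s%:R) in
  exists2 e, psi s = psi b + (s%:R - b%:R) * (psi b.+1 - psi b) - e &
    0 <= e /\ (e = 0 -> (s == b) || (s == b.+1)).
Proof.
move=> p0 psi; have s0 : 0 <= s%:R :> R by rewrite ler0n.
have b0 : 0 <= b%:R :> R by rewrite ler0n.
exists (2 * p * ((s%:R - b%:R) * (s%:R - b%:R - 1)) /
  ((p + 2 * b%:R) * (p + 2 * (b%:R + 1)) * (p + 2 * s%:R))).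
  rewrite /psi -natr1; field; rewrite !gt_eqF //; lra.
have d0 : 0 < (p + 2 * b%:R) * (p + 2 * (b%:R + 1)) * (p + 2 * s%:R).
  by rewrite !mulr_gt0 //; lra.
split.
  apply: divr_ge0; last exact: ltW.
  apply: mulr_ge0; first lra.
  have [sb|bs] := leqP s b.
    have : s%:R <= b%:R :> R by rewrite ler_nat.
    nra.
  have : b%:R + 1 <= s%:R :> R by rewrite natr1 ler_nat.
  nra.
move/eqP; rewrite mulf_eq0 invr_eq0 (gt_eqF d0) orbF mulf_eq0 gt_eqF /=; last lra.
rewrite mulf_eq0 -addrA -opprD !subr_eq0 natr1 !eqr_nat //.
Qed.

Lemma balanced_sizes f g b (p p' : R) : 0 < p -> p <= p' ->
  (forall c, (b <= colour_size g c <= b.+1)%N) ->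
  \sum_c (colour_size g c)%:R / (p + 2 * (colour_size g c)%:R) = 1 :> R ->
  \sum_c (colour_size f c)%:R / (p' + 2 * (colour_size f c)%:R) = 1 :> R ->
  forall c, (b <= colour_size f c <= b.+1)%N.
Proof.
move=> p0 pp' hb; pose psi (s : nat) : R := s%:R / (p + 2 * s%:R).
rewrite -/(psi _) => sg sf.
have sf1 : 1 <= \sum_c psi (colour_size f c).
  rewrite -[leLHS]sf; apply: ler_sum => c _.
  have : 0 <= (colour_size f c)%:R :> R by rewrite ler0n.
  rewrite /psi; move: ((colour_size f c)%:R) => s s0; apply: ler_wpM2l => //;
    rewrite lef_pV2 ?posrE; lra.
have [e he] : {e : nat -> R & forall s, psi s =
  psi b + (s%:R - b%:R) * (psi b.+1 - psi b) - e s /\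
    (0 <= e s /\ (e s = 0 -> (s == b) || (s == b.+1)))}.
  apply: (@choice _ _ (fun s e => psi s = psi b + (s%:R - b%:R) * (psi b.+1 - psi b) - e /\
    (0 <= e /\ (e = 0 -> (s == b) || (s == b.+1))))).
  by move=> s; have [e h1 h2] := share_chord b s p0; exists e.
pose L (h : 'I_n -> 'I_k) := \sum_c (psi b + ((colour_size h c)%:R - b%:R) * (psi b.+1 - psi b)).
have Lfg : L f = L g.
  have E h : L h = psi b *+ k + (n%:R - b%:R *+ k) * (psi b.+1 - psi b).
    rewrite /L big_split /= sumr_const card_ord -mulr_suml sumrB sumr_const card_ord.
    by rewrite -natr_sum sum_colour_size.
  by rewrite !E.
have Lg : L g = 1.
  rewrite -sg; apply: eq_bigr => c _.
  have : (colour_size g c == b) || (colour_size g c == b.+1).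
    by have := hb c; rewrite leq_eqVlt eq_sym; case: eqP => //= _; case: eqP => // ne /andP[];
      lia.
  case/orP => /eqP ->; first by rewrite subrr mul0r addr0.
  by rewrite -natr1 addrAC subrr add0r mul1r addrC subrK natr1.
have e0 : \sum_c e (colour_size f c) = 0.
  apply/eqP; rewrite eq_le sumr_ge0 ?andbT => [|c _]; last by have [_ []] := he (colour_size f c).
  have : \sum_c psi (colour_size f c) = L f - \sum_c e (colour_size f c).
    by rewrite -sumrB; apply: eq_bigr => c _; have [] := he (colour_size f c).
  move: sf1; rewrite Lfg Lg; lra.
move=> c; have : e (colour_size f c) = 0.
  apply/eqP; have := e0 => /eqP; rewrite psumr_eq0 => [/allP /(_ c (mem_index_enum _)) //|d _].
  by have [_ []] := he (colour_size f d).
by have [_ [_ h]] := he (colour_size f c); move=> /h /orP[] /eqP ->; rewrite leqnn leqnSn.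
Qed.

Lemma two_values_perm_eq b (s t : seq nat) :
  all (fun a => b <= a <= b.+1)%N s -> all (fun a => b <= a <= b.+1)%N t ->
  size s = size t -> sumn s = sumn t -> perm_eq s t.
Proof.
have H r : all (fun a => b <= a <= b.+1)%N r ->
    (sumn r = b * size r + count_mem b.+1 r)%N /\
    (forall a, count_mem a r = if a == b then size r - count_mem b.+1 r
       else if a == b.+1 then count_mem b.+1 r else 0)%N /\ (count_mem b.+1 r <= size r)%N.
  elim: r => [|c r IH] /=; first by move=> _; rewrite muln0; split => //; split => // a;
    case: ifP => //; case: ifP.
  case/andP=> hc /IH [-> [h2 h3]].
  have {hc} : c = b \/ c = b.+1 by lia.
  have nb : (b == b.+1) = false by rewrite ltn_eqF.
  have bn : (b.+1 == b) = false by rewrite gtn_eqF.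
  move=> hc; split; first by rewrite mulnS; case: hc => ->; rewrite ?eqxx ?nb;
    move: (b * _)%N (count _ _) => u v; lia.
  split; last by rewrite -(add1n (size r)) leq_add ?leq_b1.
  move=> a; rewrite h2 [a == b]eq_sym [a == b.+1]eq_sym; case: hc => ->; rewrite ?eqxx ?nb.
    by case: (b == a); [rewrite add1n add0n subSn|rewrite !add0n].
  have [<-|_] := eqVneq b a; first by rewrite bn add0n add1n subSS.
  by case: (b.+1 == a).
move=> /H [s1 [s2 _]] /H [t1 [t2 _]] st ss.
rewrite /perm_eq; apply/allP => a _ /=; rewrite s2 t2 st.
suff -> : count_mem b.+1 s = count_mem b.+1 t by [].
by move: ss; rewrite s1 t1 st; lia.
Qed.

Lemma coloured_isomorphic f g b :
  (forall c, (b <= colour_size f c <= b.+1)%N) ->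
  (forall c, (b <= colour_size g c <= b.+1)%N) ->
  isomorphic (coloured f) (coloured g).
Proof.
move=> hf hg.
have /tuple_permP[s hs] : perm_eq [tuple colour_size f c | c < k] [tuple colour_size g c | c < k].
  apply: (@two_values_perm_eq b); rewrite ?size_map ?size_tuple //.
  - by apply/allP => _ /mapP[c _ ->].
  - by apply/allP => _ /mapP[c _ ->].
  by rewrite !sumnE !big_map -!enumT /= !big_enum /= !sum_colour_size.
have sE c : colour_size f c = colour_size g (s c).
  have := congr1 (fun t : seq nat => nth 0%N t c) hs.
  rewrite -!tnth_nth !tnth_mktuple //.
have /tuple_permP[h hh] : perm_eq [tuple s (f i) | i < n] [tuple g i | i < n].
  apply/allP => c _ /=; rewrite !count_map; apply/eqP.
  have C (u : 'I_n -> 'I_k) : count (pred1 c \o u) (enum 'I_n) = colour_size u c.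
    by rewrite -sum1_count big_mkcond big_enum /=; apply: eq_bigr => i _; case: eqP.
  rewrite -enumT -[RHS]/(count (pred1 c \o g) _) C.
  transitivity (colour_size g (s ((s^-1)%g c))); last by rewrite permKV.
  rewrite -sE; apply: eq_bigr => i _; congr (nat_of_bool _).
  by rewrite (can2_eq (permK s) (permKV s)).
exists h; split; first by exists (h^-1)%g => i; rewrite ?permK ?permKV.
have E i : s (f i) = g (h i).
  have := congr1 (fun t : seq _ => nth (f i) t i) hh.
  by rewrite -!tnth_nth !tnth_mktuple.
by move=> i j; rewrite /coloured -!E (inj_eq perm_inj).
Qed.

End Balanced.

Lemma count_modn k n c : (0 < k)%N -> (c < k)%N ->
  (\sum_(i < n) (i %% k == c)%N)%N = (n %/ k + (c < n %% k))%N.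
Proof.
move=> k0 ck; elim: n => [|n IH]; first by rewrite big_ord0 div0n mod0n.
rewrite big_ord_recr /= IH divnS // modnS.
have nk : (n %% k < k)%N by rewrite ltn_mod.
case: ifP => kn; last by move: nk; lia.
suff : (n %% k).+1 = k by lia.
apply/eqP; rewrite eqn_leq nk /= dvdn_leq //.
by move: kn; rewrite /dvdn -addn1 -modnDml addn1.
Qed.

Definition turan_colour k (k0 : (0 < k)%N) n (i : 'I_n) : 'I_k := Ordinal (ltn_pmod i k0).

Lemma turan_coloured k (k0 : (0 < k)%N) n : turan n k = coloured (@turan_colour k k0 n).
Proof. by []. Qed.

Lemma turan_sizes k (k0 : (0 < k)%N) n c :
  (n %/ k <= colour_size (@turan_colour k k0 n) c <= (n %/ k).+1)%N.
Proof.
rewrite /colour_size; have -> : (\sum_(i < n) (turan_colour k0 i == c) =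
  \sum_(i < n) (i %% k == c))%N by [].
by rewrite count_modn //; case: ltnP; rewrite ?addn0 ?addn1 leqnn ?leqnSn.
Qed.

Section SpectralTuran.
Variables (R : realType) (k n : nat).
Hypotheses (k_gt0 : (0 < k)%N) (n_gt0 : (0 < n)%N).

Lemma maximal_coloured (G : rel 'I_n) : simple_graph G -> clique_free k G ->
  (forall H : rel 'I_n, simple_graph H -> clique_free k H -> q R n H <= q R n G) ->
  n%:R - 1 < q R n G -> exists f : 'I_n -> 'I_k, G = coloured f.
Proof.
move=> gG fG maxG qn.
have [[x px] _] := perron_spec R n_gt0 (proj1 gG).
have maxp r : q R n (pullback r G) <= q R n G.
  by apply: maxG; [exact: pullback_simple|exact: pullback_clique_free].
have tG := nonadj_trans n_gt0 gG maxp qn px.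
have [f fE] := multipartite_coloured gG fG tG.
by exists f; apply/funext => i; apply/funext => j; exact: fE.
Qed.

Lemma q_le_coloured (G : rel 'I_n) : simple_graph G -> clique_free k G ->
  n%:R - 1 < q R n G -> exists f : 'I_n -> 'I_k, q R n G <= q R n (coloured f) /\
   forall H : rel 'I_n, simple_graph H -> clique_free k H -> q R n H <= q R n (coloured f).
Proof.
move=> gG fG qn.
pose rel_of (h : {ffun 'I_n * 'I_n -> bool}) : rel 'I_n := fun i j => h (i, j).
pose P h := `[< simple_graph (rel_of h) /\ clique_free k (rel_of h) >].
have rel_ofK (H : rel 'I_n) : rel_of [ffun p => H p.1 p.2] = H.
  by apply/funext => i; apply/funext => j; rewrite /rel_of ffunE.
have PG : P [ffun p => G p.1 p.2] by apply/asboolP; rewrite rel_ofK.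
have [h /asboolP[gh fh] hmax] := arg_maxP (fun h => q R n (rel_of h)) PG.
have hM (H : rel 'I_n) : simple_graph H -> clique_free k H -> q R n H <= q R n (rel_of h).
  by move=> gH fH; rewrite -(rel_ofK H); apply: hmax; apply/asboolP; rewrite rel_ofK.
have [f fE] := maximal_coloured gh fh hM (lt_le_trans qn (hM _ gG fG)).
exists f; rewrite -fE; split; [exact: hM gG fG|exact: hM].
Qed.

Theorem clique_free_q_le (G : rel 'I_n) : simple_graph G -> clique_free k G ->
  n%:R < q R n G -> q R n G <= 2 * (1 - k%:R^-1) * n%:R.
Proof.
move=> gG fG qn; have [|f [qf _]] := q_le_coloured gG fG.
  by apply: le_lt_trans qn; rewrite lerBlDr lerDl ler01.
exact: le_trans qf (coloured_q_le n_gt0 k_gt0 (lt_le_trans qn qf)).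
Qed.

Lemma turan_q_ge :
  2 * (1 - k%:R^-1) * n%:R - 2 * k%:R / n%:R <= q R n (turan n k).
Proof. rewrite (turan_coloured k_gt0); exact: coloured_q_ge (turan_sizes k_gt0 n). Qed.

Lemma coloured_q_ge_turan (f : 'I_n -> 'I_k) : n%:R < q R n (turan n k) ->
  q R n (turan n k) <= q R n (coloured f) -> isomorphic (coloured f) (turan n k).
Proof.
rewrite (turan_coloured k_gt0) => tn tf.
apply: coloured_isomorphic (turan_sizes k_gt0 n).
have sT := turan_sizes k_gt0 n.
have p0 : 0 < q R n (coloured (@turan_colour k k_gt0 n)) - n%:R by rewrite subr_gt0; exact: tn.
exact: balanced_sizes p0 (lerB tf (lexx n%:R)) sT (coloured_shares n_gt0 tn)
  (coloured_shares n_gt0 (lt_le_trans tn tf)).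
Qed.

Theorem clique_free_turan (G : rel 'I_n) : simple_graph G -> clique_free k G ->
  n%:R < q R n (turan n k) -> q R n (turan n k) <= q R n G -> isomorphic G (turan n k).
Proof.
move=> gG fG tn tG; have qn := lt_le_trans tn tG.
have qn1 : n%:R - 1 < q R n G by apply: le_lt_trans qn; rewrite lerBlDr lerDl ler01.
have [f [qf fmax]] := q_le_coloured gG fG qn1.
have [h [bh hE]] := coloured_q_ge_turan tn (le_trans tG qf).
have cE : coloured f = pullback h (turan n k).
  by apply/funext => i; apply/funext => j; exact: hE.
have qT : q R n (coloured f) = q R n (turan n k).
  by rewrite cE q_pullback_bij // (turan_coloured k_gt0); exact: coloured_simple.
have [|g gE] := maximal_coloured gG fG _ qn1.
  by move=> H gH fH; apply: le_trans (fmax H gH fH) _; rewrite qT; exact: tG.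
by rewrite gE; apply: (coloured_q_ge_turan tn); rewrite -gE; exact: tG.
Qed.

End SpectralTuran.

(** * Vertex deletion *)

Lemma q_le_2n (R : realType) n (G : rel 'I_n) : (0 < n)%N -> simple_graph G ->
  q R n G <= 2 * n%:R.
Proof.
move=> n0 gG; have [[x px] _] := perron_spec R n0 (proj1 gG).
have := perron_form gG px; have [_ x1 _] := px => f2.
have : qform G x <= \sum_i \sum_j (2 * x i ^+ 2 + 2 * x j ^+ 2).
  apply: ler_sum => i _; apply: ler_sum => j _.
  have := sqr_ge0 (x i - x j); have := sqr_ge0 (x i); have := sqr_ge0 (x j).
  by case: (G i j); rewrite ?mul1r ?mul0r; nra.
have -> : \sum_i \sum_j (2 * x i ^+ 2 + 2 * x j ^+ 2) = 4 * n%:R.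
  under eq_bigr do rewrite big_split /= sumr_const card_ord -mulr_sumr x1 mulr1.
  rewrite big_split /= sumr_const card_ord sumrMnl -mulr_sumr x1 mulr1 -mulr_natr; ring.
rewrite f2; move: (q _ _ _) (n%:R) => l N; lra.
Qed.

Section Deletion.
Variables (R : realType) (n : nat) (G : rel 'I_n.+1) (x : 'I_n.+1 -> R) (v : 'I_n.+1).
Hypotheses (gG : simple_graph G) (px : perron_vector G x) (vmin : forall i, x v <= x i).
Let N : R := n.+1%:R.
Let l : R := q R n.+1 G.
Let X : R := x v ^+ 2.
Let d i : R := (deg G i)%:R.

Let degE i : d i = \sum_j (G i j)%:R.
Proof. by rewrite /d deg_sum natr_sum. Qed.

Let Xmin i : X <= x i ^+ 2.
Proof. by have [x0 _ _] := px; rewrite /X lerXn2r ?nnegrE. Qed.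

Lemma nbr_mass i : \sum_j (G i j)%:R * x j ^+ 2 <= 1 - (N - d i) * X.
Proof.
have : 0 <= \sum_j (1 - (G i j)%:R) * (x j ^+ 2 - X).
  apply: sumr_ge0 => j _; apply: mulr_ge0; last by rewrite subr_ge0.
  by case: (G i j); rewrite ?subrr ?subr0.
have E j : (1 - (G i j)%:R) * (x j ^+ 2 - X) =
  x j ^+ 2 - X - ((G i j)%:R * x j ^+ 2 - (G i j)%:R * X) by ring.
under eq_bigr do rewrite E.
have [_ x1 _] := px.
rewrite !sumrB x1 sumr_const card_ord -mulr_natl -/N -mulr_suml -degE; lra.
Qed.

Lemma nbr_sum i : \sum_j (G i j)%:R * x j = (l - d i) * x i.
Proof.
have [_ _ e] := px; have := e i; under eq_bigr do rewrite mulrDr.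
rewrite big_split /= -mulr_suml -degE -/l; lra.
Qed.

(* Sum of [(x j - x v)^2 >= 0] over the neighbours [j] of [u]. *)
Lemma min_entry_le u : d u <= l -> X * (N + 2 * l - 4 * d u) <= 1.
Proof.
move=> dl; have : 0 <= \sum_j (G u j)%:R * (x j - x v) ^+ 2.
  by apply: sumr_ge0 => j _; rewrite mulr_ge0 // sqr_ge0.
have E j : (G u j)%:R * (x j - x v) ^+ 2 =
  (G u j)%:R * x j ^+ 2 - 2 * x v * ((G u j)%:R * x j) + (G u j)%:R * X by rewrite /X; ring.
under eq_bigr do rewrite E.
rewrite big_split /= sumrB -mulr_sumr -mulr_suml -degE nbr_sum.
have := nbr_mass u; have [x0 _ _] := px.
have : 0 <= x v * (l - d u) * (x u - x v) by rewrite !mulr_ge0 ?subr_ge0.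
rewrite /X; move: (\sum_j _) => B; nra.
Qed.

Lemma delete_min_entry : X < 1 ->
  (l - 2 * l * X - 1 + N * X) / (1 - X) <= q R n (pullback (lift v) G).
Proof.
move=> X1; have X1' : 0 < 1 - X by rewrite subr_gt0.
have [x0 x1 e] := px.
have nrm : \sum_(i < n) x (lift v i) ^+ 2 = 1 - X.
  by rewrite -x1 (bigD1_ord v) //= -/X addrAC subrr add0r.
apply: (@q_lower R n _ (fun i => x (lift v i))); rewrite ?nrm //.
  exact: pullback_simple.
rewrite mulrA divfK ?gt_eqF //.
pose w i j : R := (G i j)%:R * (x i + x j) ^+ 2.
have wv : \sum_j w v j <= 2 * l * X + 1 - N * X.
  have E j : w v j = (x v * x v) * (G v j)%:R + 2 * x v * ((G v j)%:R * x j) + (G v j)%:R * x j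
    ^+ 2.
    by rewrite /w; ring.
  under eq_bigr do rewrite E.
  rewrite !big_split /= -!mulr_sumr -degE nbr_sum; have := nbr_mass v.
  rewrite /X; move: (\sum_j _) => B; nra.
have ff : qform G x = qform (pullback (lift v) G) (fun i => x (lift v i)) + 2 * \sum_j w v j.
  have w0 : w v v = 0 by rewrite /w (proj2 gG) mul0r.
  rewrite /qform (bigD1_ord v) //= -/(w v _).
  under [X in _ + X]eq_bigr => i _ do rewrite (bigD1_ord v) //=.
  rewrite big_split /=.
  have -> : \sum_(i < n) (G (lift v i) v)%:R * (x (lift v i) + x v) ^+ 2 = \sum_j w v j.
    rewrite [RHS](bigD1_ord v) //= w0 add0r; apply: eq_bigr => i _.
    by rewrite /w (proj1 gG) addrC.
  by rewrite /w /pullback; ring.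
have := perron_form gG px; rewrite ff -/l.
move: (qform _ _) (\sum_j _) wv => F w'; lra.
Qed.

End Deletion.

Lemma deletion_gain (R : realType) (k n : nat) (G : rel 'I_n.+1) (u : 'I_n.+1) (eps : R) :
  (3 <= k)%N -> simple_graph G -> 0 < eps -> eps <= 2^-1 -> 16 / eps <= n.+1%:R ->
  (deg G u)%:R <= (1 - k%:R^-1 - eps) * n.+1%:R ->
  2 * (1 - k%:R^-1) * n.+1%:R - 1 <= q R n.+1 G ->
  exists v, q R n.+1 G - q R n.+1 G / n.+1%:R + eps / 8 <= q R n (pullback (lift v) G).
Proof.
move=> k3 gG e0 e1 Nbig du ql.
have [[x px] _] := perron_spec R (ltn0Sn n) (proj1 gG).
have [v _ vmin] := arg_minP x (isT : xpredT (ord0 : 'I_n.+1)).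
have vm i : x v <= x i by exact: vmin.
have X0 : 0 <= x v ^+ 2 := sqr_ge0 _.
have k3r : 3 <= k%:R :> R by rewrite (ler_nat R 3).
have k0r : 0 < k%:R :> R by apply: lt_le_trans k3r.
have ik : k%:R^-1 <= 3^-1 :> R by rewrite lef_pV2 ?posrE.
have ik0 : 0 < k%:R^-1 :> R by rewrite invr_gt0.
have eN : 16 <= n.+1%:R * eps by rewrite -ler_pdivrMr.
have N32 : 32 <= n.+1%:R :> R.
  by apply: le_trans Nbig; rewrite ler_pdivlMr //; lra.
have l2 := q_le_2n R (ltn0Sn n) gG.
have mle := min_entry_le px vm (u := u).
have del := delete_min_entry gG px vm.
exists v; move: mle del ql l2 du k0r k3r ik ik0 eN N32 {Nbig k3}.
move: (q R n (pullback _ _)) (q R n.+1 G) (n.+1%:R) ((deg G u)%:R) (x v ^+ 2) X0 (k%:R^-1) =>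
  q' l N d X X0 ik.
move=> mle del ql l2 du _ _ ik3 ik0 eN N32.
have N0 : 0 < N by lra.
have aN : 3^-1 * N >= ik * N by apply: ler_wpM2r => //; exact: ltW.
have dl : d <= l by nra.
have XN : X * (N + 2 * (eps * N)) <= 1.
  apply: le_trans (mle dl); apply: ler_wpM2l => //; nra.
have X1 : X < 1 by nra.
apply: le_trans (del X1); rewrite ler_pdivlMr ?subr_gt0 //.
have lm : l = l / N * N by rewrite divfK ?gt_eqF.
move: (l / N) lm => m lm; rewrite lm in ql l2 *.
have m2 : m <= 2 by rewrite -(ler_pM2r N0).
have m1 : 5 / 4 <= m by rewrite -(ler_pM2r N0); nra.
have z1 : eps <= 1 - N * X.
  rewrite leNgt; apply/negP => z1.
  have : (1 - eps) * (1 + 2 * eps) < N * X * (1 + 2 * eps) by rewrite ltr_pM2r; lra.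
  nra.
have Xe : 16 * X <= eps by nra.
have : (5 / 4 - 1) * eps <= (m - 1) * (1 - N * X) by apply: ler_pM; lra.
have mX : m * X <= 2 * X by apply: ler_wpM2r.
have eX : 0 <= eps * X by rewrite mulr_ge0 // ltW.
lra.
Qed.

Lemma pullback_contains_copy (T : finType) m n (r : 'I_m -> 'I_n) (G : rel 'I_n) (H : rel T) :
  injective r -> contains_copy (pullback r G) H -> contains_copy G H.
Proof.
by move=> ir [f [fi fH]]; exists (fun x => r (f x)); split => [x y /ir /fi|//].
Qed.

Lemma min_degree_contains_Kplus (R : realType) k : (2 <= k)%N ->
  exists C, forall n (G : rel 'I_n) t, simple_graph G ->
  (forall u, (1 - k%:R^-1 - (4 * k ^ 2)%:R^-1) * n%:R <= (deg G u)%:R :> R) ->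
  ~ clique_free k G -> (2 ^ (C * t) <= n)%N -> contains_copy G (Kplus k t).
Proof.
move=> k2; pose L := (4 * k * (k.+1 * k.+1))%N.
have k0r : 0 < k%:R :> R by rewrite ltr0n; lia.
have L0 : (0 < L)%N by rewrite /L; lia.
have [C hC] := dense_blocks k L0; exists C => n G t gG hdeg nfree tn.
have [s [sS pS]] : exists s : seq 'I_n, size s = k.+1 /\ pairwise G s.
  apply: contrapT => h; apply: nfree => s sS; apply/negP => pS; apply: h; by exists s.
have x0 : 'I_n by case: s sS {pS} => // x s _; exact: x.
have codeg z : (4 * k ^ 2 * #|[pred w | ~~ G w z]| <= (4 * k + 1) * #|'I_n|)%N.
  have cz : (#|[pred w | ~~ G w z]| + deg G z = n)%N.
    rewrite deg_sum -sum1_card big_mkcond -big_split -[RHS]card_ord -sum1_card.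
    apply: eq_bigr => w _; rewrite unfold_in /= (proj1 gG w z); by case: (G z w).
  rewrite card_ord -(ler_nat R) !natrM natrD natrM.
  have := hdeg z; rewrite !natrM; move: cz => /(congr1 (fun m => m%:R : R)); rewrite natrD.
  move: (#|_|%:R) ((deg G z)%:R) (n%:R) (k%:R) k0r => c d N K K0 cd.
  have -> : d = N - c by rewrite -cd [c + d]addrC addrK.
  have -> : (1 - K^-1 - (4 * (K * K))^-1) * N = N - (4 * K + 1) * N / (4 * (K * K)).
    by field; rewrite gt_eqF.
  by rewrite lerD2l lerN2 ler_pdivlMr ?mulr_gt0 // mulrC.
have [p dp] := dense_joint (proj1 gG) k2 codeg sS pS.
have [||A [PA cA iA]] := hC _ G (joint G k p) x0 t (proj1 gG) (proj2 gG) _ dp.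
- by move=> s' /and4P[-> ->].
- by rewrite card_ord.
exact: joint_blocks_Kplus (proj1 gG) (proj2 gG) k2 PA cA iA.
Qed.

Section Constants.
Variables (R : realType) (k : nat).
Hypothesis k_ge3 : (3 <= k)%N.

Lemma natr_gt0 : 0 < k%:R :> R. Proof. by rewrite ltr0n; lia. Qed.

Lemma invr_le_third : k%:R^-1 <= 3^-1 :> R.
Proof. by rewrite lef_pV2 ?posrE ?natr_gt0 // (ler_nat R 3). Qed.

Lemma inv_4sqr_gt0 : 0 < (4 * k ^ 2)%:R^-1 :> R.
Proof. by rewrite invr_gt0 ltr0n; move: k_ge3; nia. Qed.

Lemma inv_4sqr_le_half : (4 * k ^ 2)%:R^-1 <= 2^-1 :> R.
Proof. by rewrite lef_pV2 ?posrE ?ltr0n ?(ler_nat R 2) //; move: k_ge3; nia. Qed.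

End Constants.

Section Descent.
Variables (R : realType) (k C t : nat) (M : R).
Hypothesis k_ge3 : (3 <= k)%N.
Let a : R := 1 - k%:R^-1.
Let eps : R := (4 * k ^ 2)%:R^-1.
Let eta : R := eps / 8.
Let B : R := expR (2 / k%:R / eta).
Hypothesis hC : forall n (G : rel 'I_n), simple_graph G ->
  (forall u, (a - eps) * n%:R <= (deg G u)%:R) ->
  ~ clique_free k G -> (2 ^ (C * t) <= n)%N -> contains_copy G (Kplus k t).
Hypotheses (M1 : (2 ^ (C * t))%:R * B <= M) (M2 : 16 / eps * B <= M).

(* The density [q / n] grows by [eta / (n - 1)] at each deletion, while it never
   exceeds [2]; so it stops after losing only a constant proportion [1/B]. *)
Lemma descent n (G : rel 'I_n) : simple_graph G -> (0 < n)%N ->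
  2 * a * n%:R < q R n G -> n%:R * (2 * a + eta * ln (M / n%:R)) <= q R n G ->
  contains_copy G (Kplus k t).
Proof.
have k0 := natr_gt0 R k_ge3; have ik := invr_le_third R k_ge3.
have e0 := inv_4sqr_gt0 R k_ge3; have e2 := inv_4sqr_le_half R k_ge3; rewrite -/eps in e0 e2.
have eta0 : 0 < eta by rewrite divr_gt0.
have B0 : 0 < B := expR_gt0 _.
have M0 : 0 < M by apply: lt_le_trans M2; rewrite mulr_gt0 // divr_gt0.
elim: n G => [//|n IH] G gG _ qa qln.
have N0 : 0 < n.+1%:R :> R by rewrite ltr0n.
have NB : M <= n.+1%:R * B.
  have := le_trans qln (q_le_2n R (ltn0Sn n) gG).
  rewrite mulrC ler_pM2r // => h.
  have : ln (M / n.+1%:R) <= 2 / k%:R / eta.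
    by rewrite ler_pdivlMr // mulrC; move: h; rewrite /a; lra.
  rewrite -ler_expR lnK ?posrE ?divr_gt0 // ler_pdivrMr // => h2.
  by rewrite mulrC.
have n1 : 16 / eps <= n.+1%:R by rewrite -(ler_pM2r B0); exact: le_trans M2 NB.
have n2 : (2 ^ (C * t) <= n.+1)%N.
  by rewrite -(ler_nat R) -(ler_pM2r B0); exact: le_trans M1 NB.
have aN : n.+1%:R < 2 * a * n.+1%:R by rewrite -[ltLHS]mul1r ltr_pM2r // /a; lra.
have [[u hu]|nu] := pselect (exists u, (deg G u)%:R <= (a - eps) * n.+1%:R); last first.
  apply: (hC gG) n2 => [u|fG].
    by rewrite leNgt; apply/negP => h; apply: nu; exists u; exact: ltW.
  have := clique_free_q_le (ltnW (ltnW k_ge3)) (ltn0Sn n) gG fG (lt_trans aN qa).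
  by rewrite leNgt => /negP; apply.
have [|v hv] := deletion_gain k_ge3 gG e0 e2 n1 hu.
  by apply: ltW; apply: lt_trans qa; rewrite -/a ltrBlDr ltrDl.
apply: (pullback_contains_copy (@lift_inj _ v)).
have n0 : (0 < n)%N.
  have : 32 <= n.+1%:R :> R by apply: le_trans n1; rewrite ler_pdivlMr //; lra.
  by rewrite (ler_nat R 32); case: (n).
have n0r : 0 < n%:R :> R by rewrite ltr0n.
move: hv; have N1 : n.+1%:R = n%:R + 1 :> R by rewrite natr1.
rewrite -/eta; set q' := q R n _; set l := q R n.+1 G in qa qln *.
have -> : l - l / n.+1%:R = l / n.+1%:R * n%:R.
  by rewrite N1; field; rewrite gt_eqF // -N1.
move=> hv; have ml : 2 * a < l / n.+1%:R by rewrite ltr_pdivlMr.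
have mln : 2 * a + eta * ln (M / n.+1%:R) <= l / n.+1%:R by rewrite ler_pdivlMr // mulrC.
apply: IH => //; first exact: pullback_simple.
  by apply: lt_le_trans hv; rewrite -[ltLHS]addr0 ltrD // ltr_pM2r.
apply: le_trans hv.
have lnM' : ln (M / n%:R) <= ln (M / n.+1%:R) + n%:R^-1.
  have -> : M / n%:R = M / n.+1%:R * (1 + n%:R^-1).
    by rewrite N1; field; rewrite !gt_eqF // -N1.
  rewrite lnM ?posrE ?divr_gt0 ?addr_gt0 ?invr_gt0 // lerD2l.
  by apply: le_ln1Dx; rewrite (lt_trans _ (_ : 0 < _)) ?invr_gt0 // oppr_lt0.
have e1 : eta * ln (M / n%:R) <= eta * (ln (M / n.+1%:R) + n%:R^-1) by rewrite ler_pM2l.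
have -> : l / n.+1%:R * n%:R + eta = n%:R * (l / n.+1%:R + eta / n%:R).
  by field; rewrite !gt_eqF ?addr_gt0.
rewrite ler_pM2l //; apply: le_trans (_ : 2 * a + eta * (ln (M / n.+1%:R) + n%:R^-1) <= _).
  by rewrite lerD2l.
by rewrite [eta * _]mulrDr addrA lerD2r.
Qed.

End Descent.

Lemma log_scale (R : realType) C n : (0 < C)%N -> (2 ^ (4 * C) <= n)%N ->
  exists t, [/\ (2 <= t)%N, (4 * C%:R)^-1 * ln (n%:R : R) <= t%:R & ((2 ^ (C * t)) ^ 2 <= n)%N].
Proof.
move=> C0 Cn; have n0 : (0 < n)%N by apply: leq_trans Cn; rewrite expn_gt0.
set L := trunc_log 2 n.
have nL : (2 ^ L <= n)%N by exact: trunc_logP.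
have L4 : (4 * C <= L)%N by exact: trunc_log_max.
pose t := (L %/ (2 * C))%N; exists t.
have C2 : (0 < 2 * C)%N by rewrite muln_gt0.
have t2 : (2 <= t)%N by rewrite leq_divRL //; lia.
split => //; last first.
  by rewrite -expnM; apply: leq_trans nL; rewrite leq_exp2l //;
    have := leq_trunc_div L (2 * C); rewrite -/t; lia.
have Lt : (L.+1 <= 4 * C * t)%N.
  have := ltn_ceil L C2; rewrite -/t => h; apply: leq_trans h _; nia.
rewrite mulrC ler_pdivrMr ?mulr_gt0 ?ltr0n //.
apply: le_trans (_ : L.+1%:R <= _); last by rewrite -[4]/(4%:R) -!natrM ler_nat mulnC.
have -> : L.+1%:R = 1 *+ L.+1 :> R by [].
apply: le_trans (_ : ln ((2 : R) ^+ L.+1) <= _).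
  rewrite ler_ln ?posrE ?ltr0n ?exprn_gt0 //.
  by rewrite -natrX ler_nat ltnW // trunc_log_ltn.
by rewrite lnXn // lerMn2r; have := @le_ln1Dx R 1; rewrite -[1 + 1]/2; apply; lra.
Qed.

Theorem theorem2p6 (R : realType) (k : nat) (hk : (3 <= k)%N) :
  exists c : R, 0 < c /\
  exists n0 : nat, forall n : nat, (n0 <= n)%N ->
  forall G : rel 'I_n, simple_graph G ->
    q R n (turan n k) <= q R n G ->
    ~ isomorphic G (turan n k) ->
    exists t : nat, (2 <= t)%N /\ c * ln (n%:R : R) <= t%:R /\
      contains_copy G (Kplus k t).
Proof.
have [C hC] := min_degree_contains_Kplus R (ltnW hk).
have k0 := natr_gt0 R hk; have ik := invr_le_third R hk.
have e0 := inv_4sqr_gt0 R hk; have e2 := inv_4sqr_le_half R hk.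
set eps : R := (4 * k ^ 2)%:R^-1 in e0 e2 hC.
set a : R := 1 - k%:R^-1 in hC.
pose B : R := expR (2 / k%:R / (eps / 8)).
have B0 : 0 < B := expR_gt0 _.
have e80 : 0 < 16 / eps by rewrite divr_gt0.
exists (4 * C.+1%:R)^-1; split; first by rewrite invr_gt0 mulr_gt0 ?ltr0n.
pose X : R := B ^+ 2 + 16 / eps * B + 2 + 16 / eps + 16 * k%:R / eps.
exists ((Num.truncn X).+1 + 2 ^ (4 * C.+1))%N => n nn G gG qG nI.
have nX : X <= n%:R.
  apply: le_trans (ltW (truncnS_gt X)) _; rewrite ler_nat; exact: leq_trans (leq_addr _ _) nn.
have [t [t2 ct tn]] := log_scale R (ltn0Sn C) (leq_trans (leq_addl _ _) nn).
exists t; split => //; split => //.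
have {}tn : ((2 ^ (C * t)) ^ 2 <= n)%N.
  by apply: leq_trans tn; rewrite -!expnM leq_exp2l //; lia.
have tn1 : (2 ^ (C * t) <= n)%N.
  by apply: leq_trans tn; rewrite -{1}[(2 ^ _)%N]expn1 leq_pexp2l // expn_gt0.
set s := (2 ^ (C * t))%N in tn tn1.
have B2 : 0 <= B ^+ 2 := sqr_ge0 _.
have eB0 : 0 <= 16 / eps * B by rewrite mulr_ge0 // ltW.
have ke0 : 0 <= 16 * k%:R / eps by rewrite divr_ge0 ?mulr_ge0 // ltW.
have n1 : 16 / eps <= n%:R by move: nX; rewrite /X; lra.
have n2 : 16 * k%:R / eps <= n%:R by move: nX; rewrite /X; lra.
have n0r : 0 < n%:R :> R by apply: lt_le_trans n1.
have n0 : (0 < n)%N by rewrite -(ltr_nat R).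
have kn0 : (0 < k)%N by exact: ltnW (ltnW hk).
have tlow := turan_q_ge R kn0 n0.
have kn : 2 * k%:R / n%:R <= eps / 8.
  by rewrite ler_pdivrMr //; move: n2; rewrite ler_pdivrMr //; clear; lra.
have tl1 : 2 * a * n%:R - eps / 8 <= q R n (turan n k).
  by apply: le_trans tlow; rewrite lerD2l lerN2.
have n32 : 32 <= n%:R :> R.
  by apply: le_trans n1; rewrite ler_pdivlMr //; lra.
have tn2 : n%:R < q R n (turan n k).
  by apply: lt_le_trans tl1; rewrite /a; nra.
have nF : ~ clique_free k G.
  by move=> fG; apply: nI; exact: (clique_free_turan kn0 n0 gG fG tn2 qG).
have [[u hu]|nu] := pselect (exists u, (deg G u)%:R <= (a - eps) * n%:R); last first.
  apply: (hC _ _ _ gG _ nF tn1) => u.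
  by rewrite leNgt; apply/negP => h; apply: nu; exists u; exact: ltW.
destruct n as [|m]; first by move: n0; rewrite ltnn.
have qlow := le_trans tl1 qG.
have [|v hv] := deletion_gain hk gG e0 e2 n1 hu.
  by apply: le_trans qlow; rewrite -/a; lra.
apply: (pullback_contains_copy (@lift_inj _ v)).
have m0 : (0 < m)%N by move: n32; rewrite (ler_nat R 32); case: (m).
have mn : m.+1%:R = m%:R + 1 :> R by rewrite natr1.
have m0r : 0 < m%:R :> R by rewrite ltr0n.
have qlow' : 2 * a * m%:R < q R m (pullback (lift v) G).
  apply: lt_le_trans hv.
  move: qlow; move: (q R m.+1 G) => l qlow; rewrite -/eps.
  have r1 : m%:R / m.+1%:R < 1 :> R by rewrite ltr_pdivrMr // mul1r ltr_nat.
  have r0 : 0 < m%:R / m.+1%:R :> R by rewrite divr_gt0.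
  have -> : l - l / m.+1%:R = l * (m%:R / m.+1%:R) by rewrite mn; field; rewrite gt_eqF ?addr_gt0.
  have {1}-> : m%:R = m.+1%:R * (m%:R / m.+1%:R) :> R by rewrite mulrC divfK ?gt_eqF.
  move: (m%:R / _) r0 r1 qlow => r r0 r1; rewrite -(ler_pM2r r0) mulrBl.
  have : eps / 8 * r < eps / 8 by rewrite -[ltRHS]mulr1 ltr_pM2l // divr_gt0.
  by rewrite -(mulrA _ _ r); lra.
have sB : s%:R * B <= m%:R.
  have s2 : s%:R ^+ 2 <= m.+1%:R :> R by rewrite -natrX ler_nat.
  have := sqr_ge0 (s%:R - B).
  by move: nX; rewrite /X mn in s2 *; nra.
have eB : 16 / eps * B <= m%:R.
  by move: nX; rewrite /X mn; lra.
apply: (descent hk (fun n G gG hd hf => hC n G t gG hd hf) sB eB) => //.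
  exact: pullback_simple.
by rewrite divff ?gt_eqF // ln1 mulr0 addr0 mulrC ltW.
Qed.
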